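(* Let $\mathbf{X}_n$, $n\in\mathbb{Z}_+$, be a subcritical $p$-type Galton--Watson process (with immigration, as defined in the context), and let $I\subseteq\{1,\dots,p\}$ be the set of types $i$ for which there exist a type $j$ and integers $m_0\ge 0$ and $m\ge 1$ such that $M^{(m_0)}_{i,j}>0$ and $M^{(m)}_{j,j}>0$. Then the process has a stationary distribution $\pi$ if and only if $$\sum_{k=1}^\infty \log k\; P(\eta_i(1)=k)<\infty\qquad\text{for every type } i\in I.$$
   Context: $\mathbb{Z}_+$ is the set of nonnegative integers and $p$ is a positive integer. A $p$-type Galton--Watson process $\mathbf{X}_n=(X_{n,1},\dots,X_{n,p})^\top$, $n\in\mathbb{Z}_+$, is a $\mathbb{Z}_+^p$-valued Markov chain defined by the recursion $$\mathbf{X}_n=\sum_{i=1}^p\sum_{k=1}^{X_{n-1,i}}\boldsymbol{\xi}_i(n,k)+\boldsymbol{\eta}(n),\qquad n=1,2,\dots,$$ where the $\mathbb{Z}_+^p$-valued random vectors $\mathbf{X}_0$, $\boldsymbol{\xi}_i(n,k)$, $\boldsymbol{\eta}(n)$ ($i=1,\dots,p$; $n,k=1,2,\dots$) are independent of each other; for each $i$ the offspring variables $\boldsymbol{\xi}_i(n,k)$, $n,k\ge1$, are identically distributed; and the innovation variables $\boldsymbol{\eta}(n)$, $n\ge1$, are identically distributed. (The components of a single offspring or innovation vector may be dependent.) Standing assumption: all offspring variables have finite expectation. The mean matrix is $\mathbf{M}=[E\boldsymbol{\xi}_1(1,1),\dots,E\boldsymbol{\xi}_p(1,1)]^\top$ (so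 $M_{i,j}$ is the expectation of the $j$-th component of $\boldsymbol{\xi}_i(1,1)$), $\varrho(\mathbf{M})$ is its spectral radius, and the process is called subcritical if $\varrho(\mathbf{M})<1$. $M^{(n)}_{i,j}$ denotes the $(i,j)$-th entry of $\mathbf{M}^n$ (with $\mathbf{M}^0$ the identity matrix), and $\eta_i(n)$ denotes the $i$-th component of $\boldsymbol{\eta}(n)$. A stationary distribution is a probability measure on $\mathbb{Z}_+^p$ that is invariant for the Markov chain. *)

(* Defs.v *)
From HB Require Import structures.
From mathcomp Require Import all_boot all_order all_algebra.
From mathcomp Require Import finmap complex.
From mathcomp Require Import all_classical all_reals all_analysis.

Set Implicit Arguments.
Unset Strict Implicit.
Unset Printing Implicit Defensive.

Import Order.TTheory GRing.Theory Num.Theory.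
Import numFieldNormedType.Exports.

Local Open Scope classical_set_scope.
Local Open Scope ring_scope.

(* Z_+^p, a countable set, carries the discrete sigma-algebra.  'cV[nat]_p is
   an additive monoid, so that sums of random vectors are ordinary \sum's. *)
Definition zvec (p : nat) : Type := 'cV[nat]_p.

HB.instance Definition _ (p : nat) := Pointed.on (zvec p).
HB.instance Definition _ (p : nat) := GRing.Nmodule.on (zvec p).
HB.instance Definition _ (p : nat) := @isMeasurable.Build
  default_measure_display (zvec p) discrete_measurable
  discrete_measurable0 discrete_measurableC discrete_measurableU.

Section GaltonWatson.
Context {d : measure_display} {Omega : measurableType d} {R : realType}.
Variables (P : probability Omega R) (p : nat).

Definition mutually_independent {I : choiceType} (Y : I -> {RV P >-> zvec p}) :=
  forall (J : {fset I}) (B : I -> set (zvec p)),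
    (forall i, measurable (B i)) ->
    P (\bigcap_(i in [set` J]) (Y i @^-1` B i)) =
    (\prod_(i <- J) P (Y i @^-1` B i))%E.

Definition identically_distributed (Y Z : {RV P >-> zvec p}) :=
  forall B : set (zvec p), measurable B ->
    distribution P Y B = distribution P Z B.

(* Times n and offspring labels k are shifted by one: xi i n k stands for
   xi_i(n+1, k+1), and eta n for eta(n+1). *)
Variables (xi : 'I_p -> nat -> nat -> {RV P >-> zvec p})
          (eta : nat -> {RV P >-> zvec p}).

Definition gw_family (X0 : {RV P >-> zvec p})
    (a : unit + 'I_p * nat * nat + nat) : {RV P >-> zvec p} :=
  match a with
  | inl (inl _) => X0
  | inl (inr (i, n, k)) => xi i n k
  | inr n => eta n
  end.

Definition gw_step (n : nat) (x : zvec p) (w : Omega) : zvec p :=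
  \sum_(i < p) \sum_(k < x i 0) xi i n k w + eta n w.

Record galton_watson (X : nat -> {RV P >-> zvec p}) : Prop := {
  gw_indep : mutually_independent (gw_family (X 0%N));
  gw_offspring_id : forall i n k n' k',
    identically_distributed (xi i n k) (xi i n' k');
  gw_innovation_id : forall n n', identically_distributed (eta n) (eta n');
  gw_rec : forall n w, X n.+1 w = gw_step n (X n w) w;
  gw_offspring_integrable : forall i n k j,
    P.-integrable setT (fun w => ((xi i n k w j 0)%:R : R)%:E)
}.

Definition mean_matrix : 'M[R]_p :=
  \matrix_(i, j) fine ('E_P[fun w => ((xi i 0%N 0%N w j 0)%:R)%R])%E.

(* The offspring and innovation laws do not depend on n, so any time gives the
   same kernel. *)
Definition gw_transition (x : zvec p) (B : set (zvec p)) : \bar R :=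
  P (gw_step 0 x @^-1` B).

Definition stationary (pi : probability (zvec p) R) :=
  forall B : set (zvec p), measurable B ->
    pi B = (\int[pi]_x gw_transition x B)%E.

End GaltonWatson.

Definition spectral_radius {R : realType} {p : nat} (A : 'M[R]_p) : R :=
  sup [set r : R | exists2 z : R[i],
    eigenvalue (map_mx (real_complex R) A) z & r = ComplexField.Normc.normc z].

Definition leads_to_cycle {R : realType} {p : nat} (M : 'M[R]_p) : set 'I_p :=
  [set i | exists (j : 'I_p) (m0 m : nat),
     [/\ (1 <= m)%N, 0 < (M ^+ m0) i j & 0 < (M ^+ m) j j]].

(* Main.v *)
Require Import Defs.
From HB Require Import structures.
From mathcomp Require Import all_boot all_order all_algebra.
From mathcomp Require Import finmap complex ring lra.
From mathcomp Require Import all_classical all_reals all_analysis.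
From mathcomp Require Import measurable_realfun.

Import Order.TTheory GRing.Theory Num.Theory.
Import numFieldNormedType.Exports.

(** The generating function of the one-step law from [x] is
    [s |-> f(s)^x g(s)], with [f_i] and [g] the generating functions of the
    offspring and innovation laws.  Hence a stationary [pi] has
    [E_pi s^x <= prod_(k < n) g(f^k(s))] with [f^k] the [k]-th iterate, so that
    [sum_k (1 - g(f^k(s)))] converges for [0 < s <= 1].  If [i] leads to a cycle,
    [1 - f^k_i(s)] is at least geometric along an arithmetic progression of [k],
    and [sum_k (1 - (1 - c a^k)^x)] is comparable to [ln x], whence the
    logarithmic moment.

    Conversely [1 - f^k(s) <= M^k (1 - s)] decays geometrically and vanishes for
    [k >= p] at the types that lead to no cycle, so under the moment condition
    [sum_k (1 - g(f^k(s)))] tends to [0] as [s] tends to [1]: the laws of the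
    chain started from [0] are tight.  These laws are stochastically increasing,
    hence the probability of each state converges, and the limit is
    stationary. *)

Local Open Scope classical_set_scope.
Local Open Scope ring_scope.

(** * Logarithms and geometric sums *)

(** The comparison with [ln x] goes through [saturate y = y / (1 + y)]: it matches [1 - (1 - e)^x]
    at [y = x e] up to a factor 2, and it is squeezed, up to constants, by the increments of
    [ln (1 + y)] along a geometric sequence, which telescope. The mean matrix may be reducible.
    Lower bounds on [1 - f^k_i(s)] therefore follow a path from [i] to a cycle and then repeated
    turns of that cycle, whence the arithmetic progression of [k]. In the sufficiency, types outside
    [I] carry no logarithmic moment. They influence only the terms with [k < p]; these are finitely
    many, and [s] is brought close to 1 only after the tail of the series has been cut. The laws of
    the chain after [n] steps are not built as measures. They appear as functionals
    [phi |-> (T^n phi)(0)], with [T] the averaging operator of the kernel, and only their limit is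
    realised as a measure. *)

Definition saturate {R : realType} (y : R) : R := y / (1 + y).

Lemma saturate_ge0 (R : realType) (y : R) : 0 <= y -> 0 <= saturate y.
Proof. by move=> y0; rewrite divr_ge0// addr_ge0. Qed.

Lemma saturate_le1 (R : realType) (y : R) : 0 <= y -> saturate y <= 1.
Proof. by move=> y0; rewrite ler_pdivrMr ?mul1r; lra. Qed.

Lemma saturate_le (R : realType) (y : R) : 0 <= y -> saturate y <= y.
Proof. by move=> y0; rewrite ler_pdivrMr; nra. Qed.

Lemma saturate_mono (R : realType) (y z : R) :
  0 <= y -> y <= z -> saturate y <= saturate z.
Proof.
by move=> y0 yz; rewrite ler_pdivrMr 1?mulrAC ?ler_pdivlMr; nra.
Qed.

(** Equivalent to [(1 - e)^k (1 + k e) <= 1], whose left side is nonincreasing in [k] because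
    [(1 - e) (1 + (k + 1) e) <= 1 + k e]. *)
Lemma saturate_le_onem_expr (R : realType) (e : R) (k : nat) : 0 <= e <= 1 ->
  saturate (k%:R * e) <= 1 - (1 - e) ^+ k.
Proof.
move=> /andP[e0 e1].
have k0 : 0 <= k%:R * e by rewrite mulr_ge0.
suff : (1 - e) ^+ k * (1 + k%:R * e) <= 1 by rewrite ler_pdivrMr; nra.
elim: k {k0} => [|k IH]; first by rewrite expr0; lra.
apply: le_trans IH; rewrite exprSr -mulrA ler_wpM2l ?exprn_ge0 ?subr_ge0//.
by have := ler0n R k; rewrite -natr1; nra.
Qed.

(** The left side is at most [1] and at most [k e], and [min(1, y) <= 2 y / (1 + y)]. *)
Lemma onem_expr_le_saturate (R : realType) (e : R) (k : nat) : 0 <= e <= 1 ->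
  1 - (1 - e) ^+ k <= 2 * saturate (k%:R * e).
Proof.
move=> /andP[e0 e1].
have k0 : 0 <= k%:R * e by rewrite mulr_ge0.
have p0 : 0 <= (1 - e) ^+ k by rewrite exprn_ge0 ?subr_ge0.
have : 1 - (1 - e) ^+ k <= k%:R * e.
  elim: k {k0 p0} => [|k IH]; first by rewrite expr0; lra.
  have p1 : (1 - e) ^+ k <= 1 by apply: exprn_ile1; lra.
  by rewrite exprSr -natr1; nra.
by rewrite mulrA ler_pdivlMr; nra.
Qed.

Lemma ln_nat_ge0 (R : realType) (k : nat) : 0 <= ln (k%:R : R).
Proof. by case: k => [|k]; [rewrite ln0|rewrite ln_ge0// ler1n]. Qed.

(** Since [(1 + r y) / (1 + y) = 1 - (1 - r) saturate y], this is an instance of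
    [ln (1 - z) <= - z]. *)
Lemma saturate_le_ln (R : realType) (r y : R) : 0 < r < 1 -> 0 <= y ->
  (1 - r) * saturate y <= ln (1 + y) - ln (1 + r * y).
Proof.
move=> /andP[r0 r1] y0.
have y1 : 0 < 1 + y by lra.
have ry1 : 0 < 1 + r * y by nra.
rewrite -lerN2 opprB -ln_div ?posrE//.
have -> : (1 + r * y) / (1 + y) = 1 + - ((1 - r) * saturate y).
  by rewrite /saturate; field; rewrite gt_eqF.
apply: le_ln1Dx; rewrite ltrN2.
have := saturate_le1 _ _ y0; have := saturate_ge0 _ _ y0; nra.
Qed.

Lemma ln_le_saturate (R : realType) (a y : R) : 0 < a < 1 -> 0 <= y ->
  ln (1 + y) - ln (1 + a * y) <= a^-1 * saturate y.
Proof.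
move=> /andP[a0 a1] y0.
have y1 : 0 < 1 + y by lra.
have ay1 : 0 < 1 + a * y by nra.
rewrite -ln_div ?posrE//.
have -> : (1 + y) / (1 + a * y) = 1 + (1 - a) * y / (1 + a * y).
  by field; rewrite gt_eqF.
have h0 : 0 <= (1 - a) * y / (1 + a * y) by rewrite divr_ge0; nra.
apply: (le_trans (le_ln1Dx _)); first by lra.
rewrite /saturate mulrA ler_pdivlMr// mulrAC ler_pdivrMr// -(ler_pM2l a0).
by rewrite !mulrA divff ?gt_eqF// mul1r; nra.
Qed.

(* Both sums over [k] are compared with [ln (1 + y) - ln (1 + y r^n)], which
   telescopes. *)
Lemma sum_saturate_le_ln (R : realType) (r y : R) (n : nat) :
  0 < r < 1 -> 0 <= y ->
  \sum_(k < n) saturate (y * r ^+ k) <= (1 - r)^-1 * ln (1 + y).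
Proof.
move=> r01 y0; have /andP[r0 r1] := r01.
rewrite ler_pdivlMl ?subr_gt0// mulr_sumr.
suff /le_trans : \sum_(k < n) (1 - r) * saturate (y * r ^+ k) <=
    ln (1 + y) - ln (1 + y * r ^+ n).
  by apply; rewrite gerBl ln_ge0// lerDl mulr_ge0// exprn_ge0// ltW.
elim: n => [|n IH]; first by rewrite big_ord0 expr0 mulr1 subrr.
have h := saturate_le_ln _ _ (y * r ^+ n) r01.
have {}h := h (mulr_ge0 y0 (exprn_ge0 _ (ltW r0))).
by rewrite big_ord_recr/= exprSr mulrA (mulrC _ r); lra.
Qed.

Lemma ln_le_sum_saturate (R : realType) (a y : R) (n : nat) :
  0 < a < 1 -> 0 <= y ->
  ln (1 + y) - ln (1 + y * a ^+ n) <=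
  a^-1 * \sum_(k < n) saturate (y * a ^+ k).
Proof.
move=> a01 y0; have /andP[a0 a1] := a01; rewrite mulr_sumr.
elim: n => [|n IH]; first by rewrite big_ord0 expr0 mulr1 subrr.
have h := ln_le_saturate _ _ (y * a ^+ n) a01.
have {}h := h (mulr_ge0 y0 (exprn_ge0 _ (ltW a0))).
by rewrite big_ord_recr/= exprSr mulrA (mulrC _ a); lra.
Qed.

Lemma prodr_ge0_le1 (R : realType) (I : Type) (J : seq I) (a : I -> R) :
  (forall i, 0 <= a i <= 1) -> 0 <= \prod_(i <- J) a i <= 1.
Proof.
move=> a01; elim/big_ind : _ => [|x y /andP[x0 x1] /andP[y0 y1]|//].
  by rewrite ler01 lexx.
by rewrite mulr_ge0//= mulr_ile1.
Qed.

Lemma onem_prod_le (R : realType) (I : Type) (J : seq I) (a : I -> R) :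
  (forall i, 0 <= a i <= 1) ->
  1 - \prod_(i <- J) a i <= \sum_(i <- J) (1 - a i).
Proof.
move=> a01; elim: J => [|i J IH]; first by rewrite !big_nil subrr.
rewrite !big_cons; have /andP[a0 a1] := a01 i.
by have /andP[] := prodr_ge0_le1 _ _ J _ a01; nra.
Qed.

(** Each factor contributes [1 - a_i <= - ln a_i]. The positive lower bound [c] keeps every factor
    away from 0, where [ln] only has a default value. *)
Lemma sum_onem_le_ln_prod (R : realType) (a : nat -> R) (n : nat) (c : R) :
  0 < c -> (forall i, a i <= 1) -> (forall i, 0 <= a i) ->
  c <= \prod_(i < n) a i ->
  \sum_(i < n) (1 - a i) <= - ln c.
Proof.
move=> c0 a1 a0 cp.
suff : 0 < \prod_(i < n) a i /\
    \sum_(i < n) (1 - a i) <= - ln (\prod_(i < n) a i).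
  by move=> [p0] /le_trans; apply; rewrite lerN2 ler_ln ?posrE.
split; first exact: lt_le_trans cp.
have {cp} : 0 < \prod_(i < n) a i by exact: lt_le_trans cp.
elim: n => [|n IH]; first by rewrite !big_ord0 ln1 oppr0.
rewrite !big_ord_recr/=; set q := \prod_(i < n) _ => qa0.
have q0 : 0 <= q by apply: prodr_ge0.
have {}q0 : 0 < q.
  by rewrite lt0r q0 andbT; apply: contraTneq qa0 => ->; rewrite mul0r ltxx.
have an0 : 0 < a n by rewrite pmulr_rgt0 in qa0.
rewrite lnM ?posrE// opprD lerD ?IH//.
rewrite lerNr opprB; have -> : a n = 1 + (a n - 1) by rewrite addrC subrK.
by apply: (le_trans (le_ln1Dx _)); lra.
Qed.

(** * Powers of nonnegative matrices *)

Lemma mxpow_ge0 (R : realType) (p : nat) (A : 'M[R]_p) (k : nat) (i j : 'I_p) :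
  (forall i j, 0 <= A i j) -> 0 <= (A ^+ k) i j.
Proof.
move=> A0; elim: k i j => [|k IH] i j; first by rewrite expr0 !mxE ler0n.
by rewrite exprS !mxE sumr_ge0// => l _; rewrite mulr_ge0.
Qed.

Lemma mxpow_gt0_split (R : realType) (p : nat) (A : 'M[R]_p) (k : nat)
    (i j : 'I_p) : (forall i j, 0 <= A i j) -> 0 < (A ^+ k.+1) i j ->
  exists l, 0 < A i l /\ 0 < (A ^+ k) l j.
Proof.
move=> A0; rewrite exprS mxE => /gt_eqF/negbT.
rewrite psumr_neq0 => [|l _]; last by rewrite mulr_ge0// mxpow_ge0.
move=> /hasP[l _ /=]; rewrite lt0r mulf_eq0 negb_or.
by move=> /andP[/andP[a0 b0] _]; exists l; rewrite !lt0r A0 mxpow_ge0// a0 b0.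
Qed.

(** Paths are total functions on [nat] of which only the values up to [k] matter, so that cutting
    and shifting them needs no resizing. *)
Lemma mxpow_path (R : realType) (p : nat) (A : 'M[R]_p) (k : nat)
    (i j : 'I_p) : (forall i j, 0 <= A i j) -> 0 < (A ^+ k) i j ->
  exists x : nat -> 'I_p, x 0%N = i /\
    forall a, (a < k)%N -> 0 < A (x a) (x a.+1).
Proof.
move=> A0; elim: k i => [|k IH] i; first by exists (fun=> i).
move=> /mxpow_gt0_split-/(_ A0)[l [Ail /IH[x [x0 xP]]]].
exists (fun n => if n is n'.+1 then x n' else i); split=> // -[_|a]; last exact: xP.
by rewrite /= x0.
Qed.

Lemma path_mxpow (R : realType) (p : nat) (A : 'M[R]_p) (x : nat -> 'I_p)
    (k : nat) : (forall i j, 0 <= A i j) ->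
  (forall a, (a < k)%N -> 0 < A (x a) (x a.+1)) -> 0 < (A ^+ k) (x 0%N) (x k).
Proof.
move=> A0; elim: k x => [|k IH] x xP; first by rewrite expr0 !mxE eqxx ltr01.
rewrite exprS mxE (bigD1 (x 1%N))//= ltr_wpDr//.
  by rewrite sumr_ge0// => l _; rewrite mulr_ge0 ?mxpow_ge0.
rewrite mulr_gt0 ?xP//; apply: (IH (x \o S)) => a ak.
exact: xP.
Qed.

(* A path of length [k >= p] visits some type twice. *)
Lemma mxpow_eq0_notin_cycle (R : realType) (p : nat) (A : 'M[R]_p) (k : nat)
    (i j : 'I_p) : (forall i j, 0 <= A i j) -> (p <= k)%N ->
  ~ leads_to_cycle A i -> (A ^+ k) i j = 0.
Proof.
move=> A0 pk iI; apply/eqP/negP => /negP Aij; apply: iI.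
have : 0 < (A ^+ k) i j by rewrite lt_neqAle eq_sym Aij mxpow_ge0.
move=> /mxpow_path-/(_ A0)[x [x0 xP]].
have : ~~ injectiveb (fun a : 'I_p.+1 => x a).
  by apply/injectiveP => /leq_card; rewrite !card_ord ltnn.
move=> /injectivePn[a [b]].
wlog ab : a b / (a < b)%N.
  move=> H; rewrite -val_eqE neq_ltn => /orP[|] ab.
    by apply: (H a b) => //; rewrite -val_eqE ltn_eqF.
  by move=> /esym; apply: (H b a) => //; rewrite -val_eqE ltn_eqF.
move=> _ xab.
have bk : (b <= k)%N by rewrite (leq_trans _ pk)// -ltnS.
exists (x a), a, (b - a)%N; split; first by rewrite subn_gt0.
- rewrite -x0; apply: path_mxpow => // c ca; apply: xP.
  by rewrite (leq_trans ca)// (leq_trans _ bk)// ltnW.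
- have := path_mxpow _ _ A (fun c => x (a + c)%N) (b - a) A0.
  rewrite addn0 subnKC; last exact: ltnW.
  rewrite -xab; apply => c cab.
  by rewrite addnS; apply: xP; rewrite (leq_trans _ bk)// -ltn_subRL.
Qed.

(** * Geometric decay of matrix powers below spectral radius one *)

(** Taking [r'] strictly above both [a] and [r] avoids the factor [n] that appears when [a = r]. The
    constant [K = b 0 + C / (r' - a)] satisfies [a K + C <= K r'], which is what the induction step
    asks. *)
Lemma geometric_recurrence_bound (R : realType) (b : nat -> R) (a C r : R) :
  (forall n, 0 <= b n) -> 0 <= a < 1 -> 0 < r < 1 -> 0 <= C ->
  (forall n, b n.+1 <= a * b n + C * r ^+ n) ->
  exists C' r', [/\ 0 <= C', 0 < r' < 1 & forall n, b n <= C' * r' ^+ n].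
Proof.
move=> b0 /andP[a0 a1] /andP[r0 r1] C0 bS.
pose r' := (1 + Num.max a r) / 2.
have [ar' rr' r'1] : [/\ a < r', r < r' & r' < 1].
  by rewrite /r'; case: (leP a r) => ?; split; lra.
have r'0 : 0 < r' by exact: lt_trans rr'.
have d0 : 0 < r' - a by rewrite subr_gt0.
exists (b 0%N + C / (r' - a)), r'; split.
- by rewrite addr_ge0// divr_ge0// ltW.
- by rewrite r'0.
elim=> [|n IH]; first by rewrite expr0 mulr1 lerDl divr_ge0// ltW.
apply: (le_trans (bS n)).
have h : a * (b 0%N + C / (r' - a)) + C <= (b 0%N + C / (r' - a)) * r'.
  set c := C / (r' - a).
  have Cc : C = c * (r' - a) by rewrite divfK// gt_eqF.
  have := mulr_ge0 (b0 0%N) (ltW d0); rewrite Cc; lra.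
apply: (@le_trans _ _ ((a * (b 0%N + C / (r' - a)) + C) * r' ^+ n)).
  rewrite mulrDl -mulrA lerD// ?ler_wpM2l//.
  by rewrite lerXn2r// ?nnegrE ltW.
by rewrite exprS mulrA ler_wpM2r// exprn_ge0// ltW.
Qed.

Lemma normc_ge0 (R : realType) (z : R[i]) : 0 <= ComplexField.Normc.normc z.
Proof. by case: z => a b; exact: sqrtr_ge0. Qed.

Lemma normc_real_complex (R : realType) (x : R) :
  ComplexField.Normc.normc (real_complex R x) = `|x|.
Proof. by rewrite /= expr0n addr0 sqrtr_sqr. Qed.

(* Multiplying by ['X - z%:P] turns the sequence [b n = (q 'X^n)(A) i j] into
   [b n.+1 - z b n], so the roots of an annihilating polynomial can be removed
   one at a time. *)
Lemma cancel_factors_bound (R : realType) (p : nat) (A : 'M[R[i]]_p.+1)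
    (i j : 'I_p.+1) (s : seq R[i]) (q : {poly R[i]}) :
  (forall z, z \in s -> ComplexField.Normc.normc z < 1) ->
  (forall n, horner_mx A (\prod_(z <- s) ('X - z%:P) * q * 'X^n) i j = 0) ->
  exists C r, [/\ 0 <= C, 0 < r < 1 & forall n,
    ComplexField.Normc.normc (horner_mx A (q * 'X^n) i j) <= C * r ^+ n].
Proof.
elim: s q => [|z s IH] q s1 H.
  exists 0, 2^-1; split=> //; first by apply/andP; split; lra.
  move=> n; have := H n; rewrite big_nil mul1r => ->.
  by rewrite ComplexField.Normc.normc0 mul0r.
have [|n|C [r [C0 r01 CrP]]] := IH (('X - z%:P) * q).
- by move=> y ys; apply: s1; rewrite in_cons ys orbT.
- by have := H n; rewrite big_cons mulrCA mulrA.
have z1 : ComplexField.Normc.normc z < 1 by apply: s1; rewrite mem_head.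
apply: (@geometric_recurrence_bound _ _ (ComplexField.Normc.normc z) C r) => //.
- by move=> n; exact: normc_ge0.
- by rewrite normc_ge0; exact: z1.
move=> n; rewrite -ComplexField.Normc.normcM.
pose u := horner_mx A (('X - z%:P) * q * 'X^n) i j.
pose b (m : nat) : R[i] := horner_mx A (q * 'X^m) i j.
have bS : b n.+1 = z * b n + u.
  rewrite /b /u -mulrA mulrBl rmorphB/= mul_polyC linearZ/= !mxE.
  by rewrite mulrCA -exprS [RHS]addrC subrK.
by rewrite -/(b _) -/(b _) bS; apply: (le_trans (le_normcD _ _)); rewrite lerD2l; exact: CrP.
Qed.

(** By Cayley-Hamilton the characteristic polynomial over [R[i]] annihilates the matrix, and its
    roots all have modulus below 1. Removing every root leaves [q = 1], that is, the powers
    themselves. *)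
Lemma mxpow_geometric_bound (R : realType) (p : nat) (A : 'M[R]_p) :
  spectral_radius A < 1 ->
  exists C r, [/\ 0 <= C, 0 < r < 1 &
    forall n i j, `|(A ^+ n) i j| <= C * r ^+ n].
Proof.
case: p A => [|p] A rA.
  by exists 0, 2^-1; split=> //; [apply/andP; split; lra|move=> n []].
set Ac := map_mx (real_complex R) A.
have [s sE] := closed_field_poly_normal (char_poly Ac).
rewrite (monicP (char_poly_monic _)) scale1r in sE.
have eigenP z : eigenvalue Ac z = (z \in s).
  by rewrite eigenvalue_root_char sE root_prod_XsubC.
have s1 z : z \in s -> ComplexField.Normc.normc z < 1.
  move=> zs; apply: le_lt_trans rA; apply: ub_le_sup; last first.
    by exists z => //; rewrite eigenP.
  (* [spectral_radius] is a [sup], which dominates its elements only if the set is bounded; the sum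
     of the moduli of all roots is an upper bound. *)
  exists (\sum_(y <- s) ComplexField.Normc.normc y) => _ [y + ->].
  rewrite eigenP => ys; rewrite (big_rem y)//= lerDl sumr_ge0// => *.
  exact: normc_ge0.
have H i j : exists C r, [/\ 0 <= C, 0 < r < 1 &
    forall n, `|(A ^+ n) i j| <= C * r ^+ n].
  have [|C [r [C0 r01 CrP]]] := @cancel_factors_bound _ _ Ac i j s 1 s1.
    move=> n; rewrite mulr1 -sE rmorphM/= Cayley_Hamilton mul0r mxE//.
  exists C, r; split=> // n; have := CrP n.
  rewrite mul1r rmorphXn/= horner_mx_X -normc_real_complex.
  by rewrite /Ac -rmorphXn mxE.
have /choice[C /choice[r CrP]] := fun ij : 'I_p.+1 * 'I_p.+1 => H ij.1 ij.2.
pose rr := \big[Num.max/2^-1]_ij r ij.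
have r0 ij : 0 < r ij by have [_ /andP[]] := CrP ij.
have r1 ij : r ij < 1 by have [_ /andP[]] := CrP ij.
have C0 ij : 0 <= C ij by have [] := CrP ij.
have rrr ij : r ij <= rr by exact: le_bigmax.
exists (\sum_ij C ij), rr; split; first by rewrite sumr_ge0.
  apply/andP; split; first exact: lt_le_trans (rrr (ord0, ord0)).
  by apply/bigmax_ltP; split=> //; lra.
move=> n i j; have [_ _ /(_ n)/le_trans] := CrP (i, j); apply.
apply: ler_pM => //; first by rewrite exprn_ge0// ltW.
  by rewrite (bigD1 (i, j))//= lerDl sumr_ge0.
by rewrite lerXn2r// ?nnegrE ltW// (lt_le_trans (r0 (i, j))).
Qed.

(** * Expectations and monomials on the lattice *)

Definition is_bounded {R : realType} {T : Type} (phi : T -> R) :=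
  exists B : R, forall x, `|phi x| <= B.

Lemma unit_is_bounded (R : realType) (T : Type) (phi : T -> R) :
  (forall x, 0 <= phi x <= 1) -> is_bounded phi.
Proof.
by move=> phi01; exists 1 => x; have /andP[? ?] := phi01 x; rewrite ger0_norm.
Qed.

Lemma is_boundedD (R : realType) (T : Type) (phi psi : T -> R) :
  is_bounded phi -> is_bounded psi -> is_bounded (fun x => phi x + psi x).
Proof.
move=> [B phiB] [C psiC]; exists (B + C) => x.
by rewrite (le_trans (ler_normD _ _))// lerD.
Qed.

Lemma is_boundedZ (R : realType) (T : Type) (c : R) (phi : T -> R) :
  is_bounded phi -> is_bounded (fun x => c * phi x).
Proof. by move=> [B phiB]; exists (`|c| * B) => x; rewrite normrM ler_wpM2l. Qed.

Lemma is_bounded_cst (R : realType) (T : Type) (c : R) :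
  is_bounded (fun _ : T => c).
Proof. by exists `|c|. Qed.

Lemma is_bounded_sum (R : realType) (T I : Type) (J : seq I)
    (phi : I -> T -> R) : (forall i, is_bounded (phi i)) ->
  is_bounded (fun x => \sum_(i <- J) phi i x).
Proof.
move=> phiB; elim: J => [|i J IH].
  by exists 0 => x; rewrite big_nil normr0.
have [C H] := is_boundedD _ _ _ _ (phiB i) IH.
by exists C => x; rewrite big_cons.
Qed.

(** The properties shared by integration against a probability and by [n]-step averages from a fixed
    state, so that both can be handled without a measure behind the second. Boundedness is required
    because [expect] has default values. *)
Record mean_functional {R : realType} {T : Type} (L : (T -> R) -> R) : Prop := {
  meanD : forall phi psi, is_bounded phi -> is_bounded psi ->
    L (fun x => phi x + psi x) = L phi + L psi;
  meanZ : forall c phi, is_bounded phi -> L (fun x => c * phi x) = c * L phi;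
  mean_cst : forall c, L (fun=> c) = c;
  mean_le : forall phi psi, is_bounded phi -> is_bounded psi ->
    (forall x, phi x <= psi x) -> L phi <= L psi }.

Arguments meanD {R T L}.
Arguments meanZ {R T L}.
Arguments mean_cst {R T L}.
Arguments mean_le {R T L}.

Section MeanFunctional.
Context {R : realType} {T : Type} {L : (T -> R) -> R}.
Hypothesis meanL : mean_functional L.

Lemma mean_sum (I : Type) (J : seq I) (phi : I -> T -> R) :
  (forall i, is_bounded (phi i)) ->
  L (fun x => \sum_(i <- J) phi i x) = \sum_(i <- J) L (phi i).
Proof.
move=> phiB; elim: J => [|i J IH].
  rewrite big_nil -[RHS](mean_cst meanL); congr L.
  by apply/funext => x; rewrite big_nil.
rewrite big_cons -IH -(meanD meanL)//; last exact: is_bounded_sum.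
by congr L; apply/funext => x; rewrite big_cons.
Qed.

Lemma mean_onem (phi : T -> R) : is_bounded phi ->
  L (fun x => 1 - phi x) = 1 - L phi.
Proof.
move=> phiB; rewrite -[in RHS](mean_cst meanL 1) -mulN1r -(meanZ meanL)//.
rewrite -(meanD meanL)//; [|exact: is_bounded_cst|exact: is_boundedZ].
by congr L; apply/funext => x; rewrite mulN1r.
Qed.

Lemma mean_itv (phi : T -> R) : (forall x, 0 <= phi x <= 1) -> 0 <= L phi <= 1.
Proof.
move=> phi01; have phiB := unit_is_bounded _ _ _ phi01.
have cB c : is_bounded (fun _ : T => c) by exact: is_bounded_cst.
apply/andP; split.
  rewrite -(mean_cst meanL 0); apply: (mean_le meanL) => // x.
  by have /andP[] := phi01 x.
rewrite -(mean_cst meanL 1); apply: (mean_le meanL) => // x.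
by have /andP[] := phi01 x.
Qed.

Lemma mean_norm_le (phi : T -> R) B : (forall x, `|phi x| <= B) -> `|L phi| <= B.
Proof.
move=> phiB; have pB : is_bounded phi by exists B.
have cB c : is_bounded (fun _ : T => c) by exact: is_bounded_cst.
rewrite ler_norml; apply/andP; split.
  rewrite -(mean_cst meanL (- B)); apply: (mean_le meanL) => // x.
  by have := phiB x; rewrite ler_norml => /andP[].
rewrite -[leRHS](mean_cst meanL); apply: (mean_le meanL) => // x.
by have := phiB x; rewrite ler_norml => /andP[].
Qed.

End MeanFunctional.

(* Junk value [0] when the integral is infinite. *)
Definition expect {R : realType} {p : nat} (Q : probability (zvec p) R)
  (phi : zvec p -> R) : R := \int[Q]_x phi x.

Section Expect.
Context {R : realType} {p : nat} (Q : probability (zvec p) R).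
Implicit Types phi psi : zvec p -> R.

(** Every function on the lattice is measurable for the discrete sigma-algebra, so a bound is all
    that has to be checked. *)
Lemma integrable_bounded phi : is_bounded phi ->
  Q.-integrable setT (EFin \o phi).
Proof.
move=> [B phiB]; apply: measurable_bounded_integrable => //.
  by apply: (@le_lt_trans _ _ 1%E); [exact: probability_le1|exact: ltry].
exists B; split; first exact: num_real.
by move=> C BC x _ /=; rewrite (le_trans (phiB x))// ltW.
Qed.

Lemma EFin_expect phi : is_bounded phi ->
  (expect Q phi)%:E = (\int[Q]_x (phi x)%:E)%E.
Proof.
move=> phiB; rewrite /expect /Rintegral fineK//.
by rewrite integrable_fin_num// integrable_bounded.
Qed.

Lemma expectD phi psi : is_bounded phi -> is_bounded psi ->
  expect Q (fun x => phi x + psi x) = expect Q phi + expect Q psi.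
Proof. by move=> ? ?; apply: RintegralD => //; exact: integrable_bounded. Qed.

Lemma expectZ c phi : is_bounded phi ->
  expect Q (fun x => c * phi x) = c * expect Q phi.
Proof. by move=> ?; apply: RintegralZl => //; exact: integrable_bounded. Qed.

Lemma expect_cst c : expect Q (fun=> c) = c.
Proof.
by rewrite /expect Rintegral_cst//= probability_setT mulr1.
Qed.

Lemma expect_le phi psi : is_bounded phi -> is_bounded psi ->
  (forall x, phi x <= psi x) -> expect Q phi <= expect Q psi.
Proof. by move=> ? ? ?; apply: le_Rintegral => //; exact: integrable_bounded. Qed.

Lemma expect_mean : mean_functional (expect Q).
Proof.
split; [exact: expectD|exact: expectZ|exact: expect_cst|exact: expect_le].
Qed.

End Expect.

(** * Monomials [s^x] and their distance to 1 *)

Definition monomial {R : realType} {p : nat} (s : 'I_p -> R) (x : zvec p) : R :=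
  \prod_(i < p) s i ^+ x i 0.

Section Monomial.
Context {R : realType} {p : nat}.
Implicit Types (s : 'I_p -> R) (x : zvec p).

Lemma monomial_itv s x : (forall i, 0 <= s i <= 1) -> 0 <= monomial s x <= 1.
Proof.
move=> s01; apply: prodr_ge0_le1 => i; have /andP[s0 s1] := s01 i.
by rewrite exprn_ge0// exprn_ile1.
Qed.

Lemma monomial_is_bounded s : (forall i, 0 <= s i <= 1) ->
  is_bounded (monomial s).
Proof. by move=> s01; apply: unit_is_bounded => x; exact: monomial_itv. Qed.

Lemma onem_monomial_is_bounded s : (forall i, 0 <= s i <= 1) ->
  is_bounded (fun x => 1 - monomial s x).
Proof.
move=> s01; apply: unit_is_bounded => x.
by have /andP[? ?] := monomial_itv s x s01; lra.
Qed.

Lemma monomial0 s : monomial s 0 = 1.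
Proof. by rewrite /monomial big1// => i _; rewrite mxE expr0. Qed.

Lemma monomialD s x y : monomial s (x + y) = monomial s x * monomial s y.
Proof.
by rewrite /monomial -big_split/=; apply: eq_bigr => i _; rewrite mxE exprD.
Qed.

Lemma monomial_sum s (I : Type) (J : seq I) (x : I -> zvec p) :
  monomial s (\sum_(i <- J) x i) = \prod_(i <- J) monomial s (x i).
Proof.
elim: J => [|i J IH]; first by rewrite !big_nil monomial0.
by rewrite !big_cons monomialD IH.
Qed.

Lemma monomial_gt0 s x : (forall i, 0 < s i) -> 0 < monomial s x.
Proof. by move=> s0; apply: prodr_gt0 => i _; rewrite exprn_gt0. Qed.

Lemma monomial_le s x i : (forall i, 0 <= s i <= 1) ->
  monomial s x <= s i ^+ x i 0.
Proof.
move=> s01; rewrite /monomial (bigD1 i)//= ler_piMr//.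
  by rewrite exprn_ge0//; have /andP[] := s01 i.
apply: prodr_ile1 => j _; have /andP[s0 s1] := s01 j.
by rewrite exprn_ge0// exprn_ile1.
Qed.

Lemma onem_monomial_le s x : (forall i, 0 <= s i <= 1) ->
  1 - monomial s x <= \sum_(i < p) (1 - s i ^+ x i 0).
Proof.
move=> s01; apply: onem_prod_le => i; have /andP[s0 s1] := s01 i.
by rewrite exprn_ge0// exprn_ile1.
Qed.

Lemma onem_monomial_le_lin s x : (forall i, 0 <= s i <= 1) ->
  1 - monomial s x <= \sum_(i < p) (x i 0)%:R * (1 - s i).
Proof.
move=> s01; apply: (le_trans (onem_monomial_le _ _ s01)).
apply: ler_sum => i _; have /andP[s0 s1] := s01 i.
elim: (x i 0) => [|k IH]; first by rewrite expr0 mul0r subrr.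
have p1 : s i ^+ k <= 1 by apply: exprn_ile1.
by rewrite exprSr -natr1; nra.
Qed.

End Monomial.

(** * Independence *)

Definition zcode {p : nat} (x : zvec p) : nat := choice.pickle (x : 'cV[nat]_p).

(* [zdecode k = 0] when [k] is not a code. *)
Definition zdecode {p : nat} (k : nat) : zvec p :=
  odflt 0 (choice.unpickle k : option 'cV[nat]_p).

Lemma zcodeK (p : nat) : cancel (@zcode p) zdecode.
Proof. by move=> x; rewrite /zdecode /zcode choice.pickleK. Qed.

(** At most one state, and empty when [k] is not a code: the fibers partition the lattice into
    countably many pieces on which every function is constant. *)
Definition fiber {p : nat} (k : nat) : set (zvec p) := [set x | zcode x = k].

Section Fibers.
Context {d : measure_display} {Omega : measurableType d} {R : realType}.
Variables (P : probability Omega R) (p : nat).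

Lemma measurable_preimage (Y : {RV P >-> zvec p}) (B : set (zvec p)) :
  measurable (Y @^-1` B).
Proof. exact: measurable_funPTI. Qed.

Lemma measurable_comp_zvec (Y : {RV P >-> zvec p}) (phi : zvec p -> R) :
  measurable_fun setT (phi \o Y).
Proof. by apply: measurableT_comp. Qed.

Lemma integral_fibers (Y : Omega -> zvec p) (D : set Omega)
    (F : Omega -> \bar R) : measurable_fun setT Y ->
  measurable D -> measurable_fun D F -> (forall w, D w -> (0 <= F w)%E) ->
  (\int[P]_(w in D) F w =
   \sum_(0 <= k <oo) \int[P]_(w in D `&` Y @^-1` fiber k) F w)%E.
Proof.
move=> mY mD mF F0.
have DE : D = \bigcup_k (D `&` Y @^-1` fiber k).
  by apply/seteqP; split=> [w Dw|w [k _ []//]]; exists (zcode (Y w)).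
rewrite [in LHS]DE ge0_integral_bigcup//.
- move=> k; apply: measurableI => //.
  by rewrite -[X in measurable X]setTI; exact: mY.
- by rewrite -DE.
- by move=> w; rewrite -DE; exact: F0.
- by move=> k l _ _ [w [[_ <-] [_ <-]]].
Qed.

Lemma measurable_addz (f g : Omega -> zvec p) :
  measurable_fun setT f -> measurable_fun setT g ->
  measurable_fun setT (fun w => f w + g w).
Proof.
move=> mf mg _ B _; rewrite setTI.
(* The event is cut along the countably many values of [f], so that each piece involves [f] and [g]
   separately. *)
have -> : (fun w => f w + g w) @^-1` B = \bigcup_k
    (f @^-1` fiber k `&` g @^-1` [set y | B (zdecode k + y)]).
  apply/seteqP; split=> [w Bw|w [k _ [/= <-]]]; last by rewrite zcodeK.
  by exists (zcode (f w)) => //; split=> //=; rewrite zcodeK.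
apply: bigcup_measurable => k _; apply: measurableI.
  by rewrite -[X in measurable X]setTI; exact: mf.
by rewrite -[X in measurable X]setTI; exact: mg.
Qed.

Lemma measurable_sumz (I : Type) (J : seq I) (f : I -> Omega -> zvec p) :
  (forall i, measurable_fun setT (f i)) ->
  measurable_fun setT (fun w => \sum_(i <- J) f i w).
Proof.
move=> mf; elim: J => [|i J IH].
  rewrite (_ : (fun _ => _) = cst 0); first exact: measurable_cst.
  by apply/funext => w; rewrite big_nil.
rewrite (_ : (fun _ => _) = fun w => f i w + \sum_(i <- J) f i w).
  exact: measurable_addz.
by apply/funext => w; rewrite big_cons.
Qed.

Lemma EFin_expect_distribution (Y : {RV P >-> zvec p}) (phi : zvec p -> R) :
  (forall x, 0 <= phi x <= 1) ->
  (expect (distribution P Y) phi)%:E = (\int[P]_w (phi (Y w))%:E)%E.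
Proof.
move=> phi01; rewrite EFin_expect; last exact: unit_is_bounded.
rewrite ge0_integral_distribution// => x.
by rewrite lee_fin; have /andP[] := phi01 x.
Qed.

Section Independence.
Variables (I : choiceType) (Y : I -> {RV P >-> zvec p}).
Hypothesis indepY : mutually_independent Y.

Lemma independent_seq (K : seq I) (B : I -> set (zvec p)) : uniq K ->
  P [set w | forall a, a \in K -> B a (Y a w)] =
  (\prod_(a <- K) fine (P (Y a @^-1` B a)))%:E.
Proof.
move=> uK.
have KE : perm_eq (enum_fset [fset x in K]%fset) K.
  by apply: uniq_perm => // x; rewrite in_fsetE.
transitivity (P (\bigcap_(i in [set` [fset x in K]%fset]) (Y i @^-1` B i))).
  congr (P _); apply/seteqP; split=> w /= H a; first by rewrite /= in_fsetE; exact: H.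
  by move=> aK; apply: H; rewrite /= in_fsetE.
rewrite indepY// (perm_big K)//= -prodEFin.
apply: eq_bigr => a _; rewrite fineK// fin_num_measure//.
exact: measurable_preimage.
Qed.

Lemma measurable_prod_comp (phi : I -> zvec p -> R) (J : seq I) :
  measurable_fun setT (fun w => \prod_(a <- J) phi a (Y a w)).
Proof.
elim: J => [|i J IH].
  rewrite (_ : (fun _ => _) = cst 1); first exact: measurable_cst.
  by apply/funext => w; rewrite big_nil.
rewrite (_ : (fun _ => _) =
    fun w => phi i (Y i w) * \prod_(i <- J) phi i (Y i w)).
  by apply: measurable_funM => //; exact: measurable_comp_zvec.
by apply/funext => w; rewrite big_cons.
Qed.

(* Variables enter through functions on [J] and through events on [K]; the
   induction moves one of them from [J] to [K] by splitting along its values. *)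
Lemma independent_prod_on (phi : I -> zvec p -> R) (J K : seq I)
    (B : I -> set (zvec p)) : (forall a x, 0 <= phi a x <= 1) -> uniq (J ++ K) ->
  (\int[P]_(w in [set w | forall a, a \in K -> B a (Y a w)])
     (\prod_(a <- J) phi a (Y a w))%:E =
   (\prod_(a <- K) fine (P (Y a @^-1` B a)) *
    \prod_(a <- J) expect (distribution P (Y a)) (phi a))%:E)%E.
Proof.
move=> phi01.
have mK (K' : seq I) B' : measurable [set w | forall a, a \in K' -> B' a (Y a w)].
  rewrite (_ : [set w | _] =
      \bigcap_(a in [set` [fset x in K']%fset]) (Y a @^-1` B' a)).
    by apply: fin_bigcap_measurable => // a _; exact: measurable_preimage.
  apply/seteqP; split=> w /= H a; first by rewrite /= in_fsetE; exact: H.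
  by move=> aK; apply: H; rewrite /= in_fsetE.
have prod0 J' w : 0 <= \prod_(a <- J') phi a (Y a w).
  by apply: prodr_ge0 => a _; have /andP[] := phi01 a (Y a w).
elim: J K B => [|a J IH] K B uJK.
  under eq_integral do rewrite big_nil.
  by rewrite integral_cst// mul1e big_nil mulr1; exact: independent_seq.
have [aJ aK uJ] : [/\ a \notin J, a \notin K & uniq (J ++ K)].
  by move: uJK; rewrite /= mem_cat negb_or => /andP[/andP[]].
set D := [set w | _].
(* The part that does not involve [a]. It factors out of every term of the series over the values of
   [Y a], and the remaining integrals reassemble to the expectation of [phi a]. *)
pose C := \prod_(a <- K) fine (P (Y a @^-1` B a)) *
    \prod_(a <- J) expect (distribution P (Y a)) (phi a).
rewrite (integral_fibers (Y a)); last 4 first.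
- exact: measurable_funPT.
- exact: mK.
- by apply: measurable_funTS; apply/measurable_EFinP; exact: measurable_prod_comp.
- by move=> w _; rewrite lee_fin prod0.
transitivity (\sum_(0 <= k <oo)
    (C%:E * \int[P]_(w in Y a @^-1` fiber k) (phi a (Y a w))%:E))%E.
  apply: eq_eseriesr => k _.
  (* Fixing the value of [Y a] is one more event, which puts [a] in [K]; the original [B a] is
     overridden harmlessly because [a] was not in [K]. *)
  pose B' b := if b == a then fiber k else B b.
  have DE : D `&` Y a @^-1` fiber k =
      [set w | forall b, b \in a :: K -> B' b (Y b w)].
    apply/seteqP; split=> w /=.
      move=> [Dw ak] b; rewrite in_cons /B'; case: eqP => [->//|_ /= bK].
      exact: Dw.
    move=> H; split; last by have := H a; rewrite mem_head /B' eqxx; exact.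
    move=> b bK; have := H b; rewrite in_cons bK orbT /B' => /(_ isT).
    by case: eqP => // ba; rewrite -ba bK in aK.
  have phiE w : (Y a @^-1` fiber k) w -> phi a (Y a w) = phi a (zdecode k).
    by move=> /= <-; rewrite zcodeK.
  have /andP[p0 p1] := phi01 a (zdecode k).
  under eq_integral => w wk.
    rewrite big_cons phiE ?EFinM; last by move: wk; rewrite inE => -[].
    over.
  under [in RHS]eq_integral => w wk.
    rewrite phiE; last by move: wk; rewrite inE.
    over.
  rewrite integral_cst; last exact: measurable_preimage.
  rewrite DE ge0_integralZl_EFin//; first last.
  - apply: measurable_funTS; apply/measurable_EFinP; exact: measurable_prod_comp.
  - by move=> w _; rewrite lee_fin prod0.
  rewrite IH; last first.
    by rewrite -(cat1s a K) uniq_catCA.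
  rewrite big_cons {1}/B' eqxx.
  rewrite (_ : \prod_(j <- K) _ =
      \prod_(a <- K) fine (P (Y a @^-1` B a))); last first.
    apply: eq_big_seq => b bK; rewrite /B'; case: eqP => // ba.
    by rewrite -ba bK in aK.
  have Pk : P (Y a @^-1` fiber k) = (fine (P (Y a @^-1` fiber k)))%:E.
    by rewrite fineK// fin_num_measure//; exact: measurable_preimage.
  rewrite [X in (_ * (_ * X))%E]Pk -!EFinM /C; congr EFin; ring.
have posI k : (0 <= \int[P]_(w in Y a @^-1` fiber k) (phi a (Y a w))%:E)%E.
  by apply: integral_ge0 => w _; rewrite lee_fin; have /andP[] := phi01 a (Y a w).
rewrite nneseriesZl//.
under eq_eseriesr do rewrite -(setTI (Y a @^-1` _)).
rewrite -integral_fibers//; last 2 first.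
- by apply/measurable_EFinP; exact: measurable_comp_zvec.
- by move=> w _; rewrite lee_fin; have /andP[] := phi01 a (Y a w).
rewrite -EFin_expect_distribution// -EFinM /C big_cons.
by congr EFin; ring.
Qed.

Lemma independent_prod (phi : I -> zvec p -> R) (J : seq I) :
  (forall a x, 0 <= phi a x <= 1) -> uniq J ->
  (\int[P]_w (\prod_(a <- J) phi a (Y a w))%:E =
   (\prod_(a <- J) expect (distribution P (Y a)) (phi a))%:E)%E.
Proof.
move=> phi01 uJ.
have := @independent_prod_on phi J [::] (fun=> setT) phi01.
rewrite cats0 big_nil mul1r => /(_ uJ) <-; congr integral.
by apply/seteqP; split.
Qed.

End Independence.
End Fibers.

(** * The one-step law *)

Definition zle {p : nat} (x y : zvec p) := forall i, (x i 0%R <= y i 0%R)%N.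

Definition antitone {R : realType} {p : nat} (phi : zvec p -> R) :=
  forall x y, zle x y -> phi y <= phi x.

Section StepLaw.
Context {d : measure_display} {Omega : measurableType d} {R : realType}.
Variables (P : probability Omega R) (p : nat).
Variables (xi : 'I_p -> nat -> nat -> {RV P >-> zvec p})
          (eta : nat -> {RV P >-> zvec p}).

Lemma measurable_gw_step n x : measurable_fun setT (gw_step xi eta n x).
Proof.
apply: measurable_addz => //.
by apply: measurable_sumz => i; apply: measurable_sumz.
Qed.

HB.instance Definition _ n x := isMeasurableFun.Build _ _ _ _
  (gw_step xi eta n x) (measurable_gw_step n x).

Definition gw_law (x : zvec p) : probability (zvec p) R :=
  distribution P (gw_step xi eta 0 x).

Definition offspring_law (i : 'I_p) : probability (zvec p) R :=
  distribution P (xi i 0%N 0%N).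

Definition innovation_law : probability (zvec p) R := distribution P (eta 0%N).

(** A coupling: both populations use the same offspring and innovation variables, and the larger one
    only adds further summands. *)
Lemma gw_step_mono n x y w : zle x y ->
  zle (gw_step xi eta n x w) (gw_step xi eta n y w).
Proof.
move=> xy j; rewrite /gw_step !mxE !summxE leq_add2r.
apply: leq_sum => i _; rewrite !summxE.
rewrite -!(big_mkord xpredT (fun k => xi i n k w j 0)).
by rewrite [leqRHS](big_cat_nat _ (xy i))//= leq_addr.
Qed.

Lemma expect_gw_law_antitone phi : (forall x, 0 <= phi x <= 1) -> antitone phi ->
  antitone (fun x => expect (gw_law x) phi).
Proof.
move=> phi01 phia x y xy; rewrite -lee_fin !EFin_expect_distribution//.
apply: ge0_le_integral => //.
- by move=> w _; rewrite lee_fin; have /andP[] := phi01 (gw_step xi eta 0 y w).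
- by apply/measurable_EFinP; exact: measurable_comp_zvec.
- by apply/measurable_EFinP; exact: measurable_comp_zvec.
- by move=> w _; rewrite lee_fin; apply: phia; exact: gw_step_mono.
Qed.

Variable (X : nat -> {RV P >-> zvec p}).
Hypothesis gwX : galton_watson xi eta X.

(** Labels, without repetition, of the variables that one step from [x] consumes: the first [x_i]
    offspring vectors of each type and one innovation. *)
Let step_index (x : zvec p) : seq (unit + 'I_p * nat * nat + nat) :=
  [seq inl (inr (i, 0%N, k)) | i <- index_enum 'I_p, k <- index_iota 0 (x i 0)]
  ++ [:: inr 0%N].

Let step_index_uniq x : uniq (step_index x).
Proof.
rewrite cat_uniq /= andbT orbF; apply/andP; split.
  apply: allpairs_uniq_dep => [|i _|]; first exact: index_enum_uniq.
    exact: iota_uniq.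
  by move=> [i k] [j l] _ _ /= [-> ->].
by apply/negP => /allpairsPdep[i [k []]].
Qed.

Let monomial_gw_step (s : 'I_p -> R) x w : monomial s (gw_step xi eta 0 x w) =
  \prod_(a <- step_index x) monomial s (gw_family xi eta (X 0%N) a w).
Proof.
rewrite big_cat big_seq1 /= big_allpairs_dep /gw_step monomialD monomial_sum.
congr (_ * _); apply: eq_bigr => i _.
by rewrite monomial_sum big_mkord.
Qed.

Lemma expect_gw_law_monomial (s : 'I_p -> R) x : (forall i, 0 <= s i <= 1) ->
  expect (gw_law x) (monomial s) =
  monomial (fun i => expect (offspring_law i) (monomial s)) x *
  expect innovation_law (monomial s).
Proof.
move=> s01; apply: EFin_inj.
have m01 z : 0 <= monomial s z <= 1 by exact: monomial_itv.
rewrite EFin_expect_distribution//.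
under eq_integral do rewrite monomial_gw_step.
rewrite (independent_prod _ _ _ _ (gw_indep gwX) (fun=> monomial s))//.
congr EFin; rewrite big_cat big_seq1 big_allpairs_dep; congr (_ * _).
(* The [x_i] offspring factors of type [i] have the same law, so their product is a power of a
   single expectation. *)
apply: eq_bigr => i _; rewrite big_mkord -[x i 0 in RHS]card_ord -prodr_const.
apply: eq_bigr => k _; congr fine; apply: eq_measure_integral => B mB _.
exact: (gw_offspring_id gwX).
Qed.

Lemma mean_matrixE i j :
  mean_matrix xi i j = expect (offspring_law i) (fun x => (x j 0)%:R).
Proof.
rewrite mxE /expect /Rintegral; congr fine.
by rewrite unlock ge0_integral_distribution.
Qed.

Lemma offspring_integrable i j :
  (offspring_law i).-integrable setT (fun x => ((x j 0)%:R : R)%:E).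
Proof.
apply/integrableP; split => //.
have /integrableP[_] := gw_offspring_integrable gwX i 0%N 0%N j.
by rewrite ge0_integral_distribution.
Qed.

End StepLaw.

Section ExpectMore.
Context {R : realType} {p : nat} (Q : probability (zvec p) R).

Lemma expect_fibers (phi : zvec p -> R) : (forall x, 0 <= phi x <= 1) ->
  (expect Q phi)%:E =
  (\sum_(0 <= k <oo) (phi (zdecode k))%:E * Q (fiber k))%E.
Proof.
move=> phi01; rewrite EFin_expect; last exact: unit_is_bounded.
rewrite (integral_fibers Q p idfun)//; last first.
  by move=> x _; rewrite lee_fin; have /andP[] := phi01 x.
apply: eq_eseriesr => k _; rewrite setTI -integral_cst//.
by apply: eq_integral => x; rewrite inE /= => <-; rewrite zcodeK.
Qed.

(** A nonnegative [psi] of mean 0 vanishes almost everywhere, hence so does [phi]. As [phi] may be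
    unbounded, the conclusion is about the extended integral. *)
Lemma expect_eq0_integral (phi psi : zvec p -> R) : is_bounded psi ->
  (forall x, 0 <= psi x) -> (forall x, 0 <= phi x) ->
  (forall x, psi x = 0 -> phi x = 0) -> expect Q psi = 0 ->
  (\int[Q]_x (phi x)%:E = 0)%E.
Proof.
move=> psiB psi0 phi0 H e0.
have {}e0 : (\int[Q]_x (psi x)%:E = 0)%E by rewrite -EFin_expect// e0.
have abs_e0 : (\int[Q]_x `|(psi x)%:E| = 0)%E.
  by rewrite -e0; apply: eq_integral => x _; rewrite /= ger0_norm.
have mE (f : zvec p -> R) : measurable_fun setT (EFin \o f) by [].
have ae0 := (ae_eq_integral_abs Q measurableT (mE psi)).1 abs_e0.
transitivity (\int[Q]_x `|(phi x)%:E|)%E.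
  by apply: eq_integral => x _; rewrite /= ger0_norm.
apply/(ae_eq_integral_abs Q measurableT (mE phi)).
by apply: filterS ae0 => x /= h /h [] /H ->.
Qed.

Lemma expect_gt0 (phi : zvec p -> R) : is_bounded phi ->
  (forall x, 0 < phi x) -> 0 < expect Q phi.
Proof.
move=> phiB phi0.
have : 0 <= expect Q phi.
  rewrite -(expect_cst Q 0); apply: expect_le => //.
    exact: is_bounded_cst.
  by move=> x; exact: ltW.
rewrite le_eqVlt => /predU1P[/esym e0|//].
have H x : phi x = 0 -> 1 = 0 :> R.
  by move=> x0; have := phi0 x; rewrite x0 ltxx.
have := expect_eq0_integral (fun=> 1) _ phiB
  (fun x => ltW (phi0 x)) (fun=> ler01) H.
rewrite -EFin_expect ?expect_cst; last exact: is_bounded_cst.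
by move=> /(_ e0)[] /eqP; rewrite oner_eq0.
Qed.

(** Linearity for the integrable but unbounded functions [F j], in practice the coordinates, to
    which [mean_functional] does not apply. *)
Lemma expect_le_integral_sum (phi : zvec p -> R) (F : 'I_p -> zvec p -> R)
    (c : 'I_p -> R) : is_bounded phi ->
  (forall j, Q.-integrable setT (EFin \o F j)) ->
  (forall x, phi x <= \sum_(j < p) F j x * c j) ->
  expect Q phi <= \sum_(j < p) expect Q (F j) * c j.
Proof.
move=> phiB FI phiF.
have sumI J :
    Q.-integrable setT (EFin \o (fun x => \sum_(j <- J) F j x * c j)) /\
    expect Q (fun x => \sum_(j <- J) F j x * c j) =
    \sum_(j <- J) expect Q (F j) * c j.
  elim: J => [|j J [IH1 IH2]].
    split; last first.
      rewrite big_nil -[RHS](expect_cst Q); congr expect.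
      by apply/funext => x; rewrite big_nil.
    by apply: integrable_bounded; exists 0 => x; rewrite big_nil normr0.
  have FcI : Q.-integrable setT (EFin \o (fun x => F j x * c j)).
    rewrite (_ : _ \o _ = fun x => ((c j)%:E * (EFin \o F j) x)%E).
      exact: integrableZl.
    by apply/funext => x /=; rewrite mulrC EFinM.
  rewrite (_ : (fun x => \sum_(j <- j :: J) _) =
      (fun x => F j x * c j + \sum_(j <- J) F j x * c j)); last first.
    by apply/funext => x; rewrite big_cons.
  split.
    exact: (integrableD measurableT FcI IH1).
  rewrite big_cons -IH2 /expect RintegralD//; congr (_ + _).
  by rewrite RintegralZr.
have [sI <-] := sumI (index_enum 'I_p).
by apply: le_Rintegral => //; exact: integrable_bounded.
Qed.

End ExpectMore.

(** * Generating functions and necessity *)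

Lemma expect_monomial_itv (R : realType) (p : nat) (Q : probability (zvec p) R)
    (s : 'I_p -> R) : (forall i, 0 <= s i <= 1) ->
  0 <= expect Q (monomial s) <= 1.
Proof.
by move=> s01; apply: (mean_itv (expect_mean Q)) => x; exact: monomial_itv.
Qed.

Section Pgf.
Context {R : realType} {p : nat}.
Variables (Lam : 'I_p -> probability (zvec p) R) (M : 'M[R]_p).
Hypothesis LamI : forall i j,
  (Lam i).-integrable setT (fun x => ((x j 0)%:R : R)%:E).
Hypothesis ME : forall i j, M i j = expect (Lam i) (fun x => (x j 0)%:R).
Implicit Types s : 'I_p -> R.

Definition offspring_pgf s : 'I_p -> R := fun i => expect (Lam i) (monomial s).

Let f := offspring_pgf.

Lemma iter_pgf_itv s k : (forall i, 0 <= s i <= 1) ->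
  forall i, 0 <= iter k f s i <= 1.
Proof.
move=> s01; elim: k => [//|k IH] i; rewrite iterS.
exact: expect_monomial_itv.
Qed.

Lemma mean_matrix_ge0 i j : 0 <= M i j.
Proof. by rewrite ME; apply: Rintegral_ge0 => x _; exact: ler0n. Qed.

Lemma onem_pgf_le s i : (forall i, 0 <= s i <= 1) ->
  1 - f s i <= \sum_j M i j * (1 - s j).
Proof.
move=> s01; rewrite /f /offspring_pgf -(mean_onem (expect_mean _)); last first.
  exact: monomial_is_bounded.
under eq_bigr do rewrite ME.
apply: expect_le_integral_sum => //.
- exact: onem_monomial_is_bounded.
- by move=> j; exact: LamI.
- by move=> x; exact: onem_monomial_le_lin.
Qed.

Lemma onem_iter_pgf_le s k i : (forall i, 0 <= s i <= 1) ->
  1 - iter k f s i <= \sum_j (M ^+ k) i j * (1 - s j).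
Proof.
move=> s01; elim: k i => [|k IH] i.
  rewrite expr0 (bigD1 i)//= !mxE eqxx mul1r lerDl sumr_ge0// => j _.
  by rewrite !mxE mulr_ge0 ?ler0n// subr_ge0; have /andP[] := s01 j.
rewrite iterS; apply: (le_trans (onem_pgf_le _ _ (iter_pgf_itv _ _ s01))).
apply: (@le_trans _ _ (\sum_l M i l * \sum_j (M ^+ k) l j * (1 - s j))).
  by apply: ler_sum => l _; rewrite ler_wpM2l// mean_matrix_ge0.
under eq_bigr do rewrite mulr_sumr.
rewrite exchange_big/=; under [leRHS]eq_bigr do rewrite exprS mxE mulr_suml.
by apply: ler_sum => j _; apply: ler_sum => l _; rewrite mulrA.
Qed.

(** The constant [c] is the probability that a parent of type [i] has a child of type [j]. On that
    event the monomial is at most [s_j], and [c > 0] because otherwise the mean [M i j] would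
    vanish. *)
Lemma onem_pgf_ge i j : 0 < M i j -> exists2 c, 0 < c &
  forall s, (forall i, 0 <= s i <= 1) -> c * (1 - s j) <= 1 - f s i.
Proof.
move=> Mij; pose psi (x : zvec p) : R := (0 < x j 0%R)%N%:R.
have psi01 x : 0 <= psi x <= 1.
  by rewrite /psi; case: ltnP => _; rewrite ?lexx ?ler01.
have psiB := unit_is_bounded _ _ _ psi01.
exists (expect (Lam i) psi) => [|s s01].
  have /andP[] := mean_itv (expect_mean (Lam i)) _ psi01.
  rewrite le_eqVlt => /predU1P[/esym e0 _|//].
  have H x : psi x = 0 -> (x j 0)%:R = 0 :> R.
    rewrite /psi; case: ltnP => [_ /eqP|]; first by rewrite oner_eq0.
    by rewrite leqn0 => /eqP ->.
  have := expect_eq0_integral (Lam i) (fun x => (x j 0)%:R) psi psiB _ _ H e0.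
  move=> /(_ (fun x => proj1 (andP (psi01 x))))/(_ (fun x => ler0n _ _)) m0.
  by move: Mij; rewrite ME /expect /Rintegral m0 ltxx.
rewrite /f /offspring_pgf -(mean_onem (expect_mean _)); last first.
  exact: monomial_is_bounded.
rewrite mulrC -expectZ//; apply: expect_le; first exact: is_boundedZ.
  exact: onem_monomial_is_bounded.
move=> x; have /andP[s0 s1] := s01 j; have /andP[m0 m1] := monomial_itv s x s01.
rewrite /psi; case: ltnP => xj; last by rewrite mulr0 subr_ge0.
rewrite mulr1 lerB// (le_trans (monomial_le s x j s01))//.
by case: (x j 0) xj => // k _; rewrite exprS ler_piMr// exprn_ile1.
Qed.

Lemma onem_iter_pgf_ge k i j : 0 < (M ^+ k) i j -> exists2 c, 0 < c &
  forall s, (forall i, 0 <= s i <= 1) -> c * (1 - s j) <= 1 - iter k f s i.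
Proof.
elim: k i => [|k IH] i.
  rewrite expr0 mxE; case: eqP => [->|]; last by rewrite ltxx.
  by exists 1 => // s _; rewrite mul1r.
move=> /mxpow_gt0_split-/(_ mean_matrix_ge0)[l [Mil /IH[c' c'0 c'P]]].
have [c c0 cP] := onem_pgf_ge _ _ Mil.
exists (c * c') => [|s s01]; first exact: mulr_gt0.
rewrite iterS -mulrA (le_trans _ (cP _ (iter_pgf_itv _ _ s01)))//.
by rewrite ler_wpM2l ?c'P// ltW.
Qed.

Lemma onem_iter_pgf_geometric i : leads_to_cycle M i ->
  exists m0 m c a, [/\ (0 < m)%N, 0 < c, 0 < a < 1 & forall l,
    c * a ^+ l <= 1 - iter (m0 + m * l) f (fun=> 2^-1) i].
Proof.
move=> [j [m0 [m [m1 Mij Mjj]]]].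
have [c0 c00 c0P] := onem_iter_pgf_ge _ _ _ Mij.
have [c1 c10 c1P] := onem_iter_pgf_ge _ _ _ Mjj.
pose h := (fun=> 2^-1) : 'I_p -> R.
have h01 : forall i, 0 <= h i <= 1 by move=> k; rewrite /h; lra.
(* Each turn of the cycle multiplies the lower bound by [c1]; the minimum makes the ratio strictly
   less than 1, as the telescoping needs. *)
pose a := Num.min c1 2^-1.
have a0 : 0 < a by rewrite lt_min c10/= invr_gt0.
have a1 : a < 1 by rewrite gt_min; apply/orP; right; lra.
exists m0, m, (c0 / 2), a; split=> //; [by rewrite divr_gt0|by rewrite a0|move=> l].
rewrite iterD (le_trans _ (c0P _ (iter_pgf_itv _ _ h01)))//.
rewrite -mulrA ler_wpM2l ?(ltW c00)//.
elim: l => [|l IH]; first by rewrite muln0 expr0 /h /=; lra.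
rewrite mulnS iterD (le_trans _ (c1P _ (iter_pgf_itv _ _ h01)))//.
rewrite exprS mulrCA ler_pM ?mulr_ge0 ?invr_ge0 ?exprn_ge0 ?(ltW a0)//.
by rewrite ge_min lexx.
Qed.

Section Necessity.
Variables (Gam pi : probability (zvec p) R).
Let g s := expect Gam (monomial s).
Hypothesis pi_pgf : forall s, (forall i, 0 <= s i <= 1) ->
  expect pi (monomial s) = expect pi (monomial (f s)) * g s.

Lemma stationary_pgf_iter s n : (forall i, 0 <= s i <= 1) ->
  expect pi (monomial s) =
  expect pi (monomial (iter n f s)) * \prod_(k < n) g (iter k f s).
Proof.
move=> s01; elim: n => [|n IH]; first by rewrite big_ord0 mulr1.
rewrite IH big_ord_recr/= pi_pgf ?mulrA; last exact: iter_pgf_itv.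
by rewrite -!mulrA (mulrC (g _)).
Qed.

Lemma sum_onem_innovation_pgf_bounded s : (forall i, 0 < s i <= 1) ->
  exists B, forall n, \sum_(k < n) (1 - g (iter k f s)) <= B.
Proof.
move=> s01; have s01' i : 0 <= s i <= 1 by have /andP[/ltW-> ->] := s01 i.
have g01 k : 0 <= g (iter k f s) <= 1.
  by apply: expect_monomial_itv; exact: iter_pgf_itv.
(* The mean of [s^x] under [pi] is positive since all [s_i] are, and it bounds every partial product
   from below, uniformly in [n]. *)
exists (- ln (expect pi (monomial s))) => n.
apply: (sum_onem_le_ln_prod R (fun k => g (iter k f s))).
- apply: expect_gt0; first exact: monomial_is_bounded.
  by move=> x; apply: monomial_gt0 => i; have /andP[] := s01 i.
- by move=> k; have /andP[] := g01 k.
- by move=> k; have /andP[] := g01 k.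
rewrite (stationary_pgf_iter s n)// ler_piMl//.
  by apply: prodr_ge0 => k _; have /andP[] := g01 k.
by have /andP[] := expect_monomial_itv _ _ pi _ (iter_pgf_itv s n s01').
Qed.

Lemma subseries_le (u : nat -> R) (m0 m n : nat) : (0 < m)%N ->
  (forall k, 0 <= u k) ->
  \sum_(l < n) u (m0 + m * l)%N <= \sum_(k < m0 + m * n) u k.
Proof.
move=> m1 u0; elim: n => [|n IH]; first by rewrite big_ord0 sumr_ge0.
rewrite big_ord_recr/=; apply: (le_trans (lerD IH (lexx _))).
rewrite -(big_mkord xpredT u) -big_nat_recr//= -(big_mkord xpredT u).
have le1 : ((m0 + m * n).+1 <= m0 + m * n.+1)%N.
  by rewrite mulnS addnCA -[leqLHS]add1n leq_add2r.
by rewrite [leRHS](big_cat_nat _ le1)//= lerDl sumr_ge0.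
Qed.

(** The truncation at [N] makes the integrand bounded, so that [expect] has its true value; the
    bound is uniform in [N]. *)
Lemma log_moment_bounded i : leads_to_cycle M i -> exists B, forall N,
  expect Gam (fun x => \sum_(k < N) ln (k%:R : R) * (x i 0 == k)%:R) <= B.
Proof.
move=> /onem_iter_pgf_geometric[m0 [m [c [a [m1 c0 a01 caP]]]]].
pose h := (fun=> 2^-1) : 'I_p -> R.
have h01 : forall i, 0 <= h i <= 1 by move=> k; rewrite /h; lra.
have [B BP] : exists B, forall n, \sum_(k < n) (1 - g (iter k f h)) <= B.
  by apply: sum_onem_innovation_pgf_bounded => k; rewrite /h; lra.
have /andP[a0 a1] := a01.
pose y l := c * a ^+ l.
have y0 l : 0 <= y l by rewrite mulr_ge0 ?exprn_ge0 ?(ltW a0) ?(ltW c0).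
have sat01 l (x : zvec p) : 0 <= saturate ((x i 0)%:R * y l) <= 1.
  by rewrite saturate_ge0 ?saturate_le1// mulr_ge0.
have satB l := unit_is_bounded _ _ _ (sat01 l).
have satP n :
    \sum_(l < n) expect Gam (fun x => saturate ((x i 0)%:R * y l)) <= B.
  apply: le_trans (BP (m0 + m * n)%N).
  apply: le_trans
    (subseries_le (fun k => 1 - g (iter k f h)) m0 m n m1 _); last first.
    move=> k; rewrite subr_ge0.
    by have /andP[] := expect_monomial_itv _ _ Gam _ (iter_pgf_itv h k h01).
  apply: ler_sum => l _; have it01 := iter_pgf_itv h (m0 + m * l) h01.
  rewrite -(mean_onem (expect_mean _)); last exact: monomial_is_bounded.
  apply: expect_le => //.
    exact: onem_monomial_is_bounded.
  move=> x; have /andP[t0 t1] := it01 i; have yl := caP l; have yl0 := y0 l.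
  have e01 : 0 <= 1 - iter (m0 + m * l) f h i <= 1 by lra.
  have := saturate_le_onem_expr _ _ (x i 0) e01; rewrite subKr => le1.
  have := monomial_le _ x i it01 => le2.
  have le3 : saturate ((x i 0)%:R * y l) <=
      saturate ((x i 0)%:R * (1 - iter (m0 + m * l) f h i)).
    by apply: saturate_mono; [rewrite mulr_ge0|exact: ler_wpM2l].
  by apply: (le_trans le3); apply: (le_trans le1); rewrite lerB.
(* Telescoping gives [ln (1 + k c) <= ln (1 + k c a^n) + a^-1 S]. The left side is at least
   [ln k + ln c], and the first term on the right will be at most [ln 2]. *)
exists (- ln c + ln 2 + a^-1 * B) => N.
(* The number [n] of terms depends on [N], but the bound [B] on the expected sum does not depend on
   [n]. *)
have [n nP] : exists n, N%:R * c * a ^+ n <= 1.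
  have : (fun n => N%:R * c * a ^+ n) @ \oo --> N%:R * c * 0.
    by apply: cvgMr; apply: cvg_expr; rewrite ger0_norm// ltW.
  rewrite mulr0 => /cvgrPdist_le /(_ 1 ltr01)[n _ /(_ n (leqnn n))].
  by rewrite /= sub0r normrN => /ler_normlW H; exists n.
pose S (x : zvec p) := \sum_(l < n) saturate ((x i 0)%:R * y l).
have SB : is_bounded S by apply: is_bounded_sum.
apply: (@le_trans _ _
    (expect Gam (fun x => (- ln c + ln 2) + a^-1 * S x))); last first.
  rewrite expectD; [|exact: is_bounded_cst|exact: is_boundedZ].
  rewrite expect_cst expectZ// lerD2l ler_wpM2l ?invr_ge0 ?(ltW a0)//.
  by rewrite /S (mean_sum (expect_mean _)).
apply: expect_le.
- apply: is_bounded_sum => k; apply: is_boundedZ; exists 1 => x.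
  by case: eqP; rewrite ?normr1 ?normr0.
- by apply: is_boundedD; [exact: is_bounded_cst|exact: is_boundedZ].
move=> x; have S0 : 0 <= S x by apply: sumr_ge0 => l _; have /andP[] := sat01 l x.
have aS0 : 0 <= a^-1 * S x by rewrite mulr_ge0// invr_ge0 ltW.
(* Makes [- ln c] nonnegative, which settles the states where the truncated logarithm is 0. *)
have c1 : c <= 1.
  have := caP 0%N; rewrite expr0 mulr1 => /le_trans; apply.
  by have /andP[? ?] := iter_pgf_itv h (m0 + m * 0) h01 i; rewrite -/h; lra.
have lc : 0 <= - ln c by rewrite oppr_ge0 ln_le0.
have l2 : 0 <= ln 2 :> R by rewrite ln_ge0// ler1n.
set k := x i 0; case: (ltnP k N) => kN; last first.
  rewrite big1; first by rewrite !addr_ge0.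
  move=> l _; rewrite (_ : _ == _ = false) ?mulr0//.
  by apply/negP => /eqP kl; move: kN; rewrite kl leqNgt ltn_ord.
rewrite (bigD1 (Ordinal kN))//= eqxx mulr1 big1 ?addr0; last first.
  move=> l; rewrite -val_eqE /= eq_sym => /negbTE ->; exact: mulr0.
have [->|k0] := posnP k; first by rewrite ln0// !addr_ge0.
have k0' : 0 < k%:R :> R by rewrite ltr0n.
have kc0 : 0 < k%:R * c by rewrite mulr_gt0.
have := ln_le_sum_saturate R a (k%:R * c) n a01 (ltW kc0).
have -> : \sum_(l < n) saturate (k%:R * c * a ^+ l) = S x.
  by apply: eq_bigr => l _; rewrite /y mulrA.
have : ln (1 + k%:R * c * a ^+ n) <= ln 2 :> R.
  have an0 : 0 <= a ^+ n by rewrite exprn_ge0// ltW.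
  have kna0 : 0 <= k%:R * c * a ^+ n by rewrite mulr_ge0// ltW.
  rewrite ler_ln ?posrE//; last by lra.
  have : k%:R * c * a ^+ n <= N%:R * c * a ^+ n.
    by rewrite ler_wpM2r// ler_wpM2r ?(ltW c0)// ler_nat ltnW.
  lra.
have : ln k%:R + ln c <= ln (1 + k%:R * c).
  by rewrite -lnM ?posrE// ler_ln ?posrE//; lra.
lra.
Qed.

End Necessity.
End Pgf.

(** * Smallness of the innovation terms *)

Lemma expect_dominated_cvg (R : realType) (p : nat) (Q : probability (zvec p) R)
    (phi : nat -> zvec p -> R) (psi : zvec p -> R) (B : R) :
  (forall n x, `|phi n x| <= B) -> (forall x, phi n x @[n --> \oo] --> psi x) ->
  expect Q (phi n) @[n --> \oo] --> expect Q psi.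
Proof.
move=> phiB phi_psi.
have psiB : is_bounded psi.
  exists B => x; have /cvg_norm/(@cvg_lim _ _)<- // := phi_psi x.
  apply: limr_le; first by apply/cvg_ex; exists `|psi x|; exact: cvg_norm.
  by apply: nearW => n.
have phinB n : is_bounded (phi n) by exists B.
suff : (\int[Q]_x (phi n x)%:E)%E @[n --> \oo] --> (\int[Q]_x (psi x)%:E)%E.
  rewrite -EFin_expect// => /fine_cvg; apply: cvg_trans; apply: near_eq_cvg.
  by apply: nearW => n /=; rewrite -EFin_expect.
apply: (@dominated_cvg _ _ _ Q setT _ _ _ (fun=> B%:E)) => //.
- by move=> x _; apply: cvg_EFin; [exact: nearW|exact: phi_psi].
- by apply: (integrable_bounded Q (fun=> B)); exact: is_bounded_cst.
- by move=> n x _; rewrite lee_fin.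
Qed.

Lemma nonneg_series_tail (R : realType) (v : nat -> R) (B : R) :
  (forall k, 0 <= v k) -> (forall n, \sum_(k < n) v k <= B) ->
  forall e, 0 < e -> exists N, forall m, (N <= m)%N -> forall n,
    \sum_(m <= k < n) v k <= e.
Proof.
move=> v0 vB e e0.
pose S n := \sum_(k < n) v k.
have supS : has_sup (range S).
  by split; [exists (S 0%N), 0%N|exists B => _ [n _ <-]; exact: vB].
have [_ [N _ <-] SN] := sup_adherent e0 supS.
exists N => m Nm n; case: (leqP m n) => [mn|/ltnW nm]; last first.
  by rewrite big_geq// ltW.
have : S n <= sup (range S) by apply: ub_le_sup; [case: supS|exists n].
rewrite /S -(big_mkord xpredT v) (big_cat_nat (leq0n m) mn)/=.
rewrite (big_cat_nat (leq0n N) Nm)/= big_mkord -/(S N).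
have : 0 <= \sum_(N <= k < m) v k by exact: sumr_ge0.
by move: SN; lra.
Qed.

Section Immigration.
Context {R : realType} {p : nat}.
Variables (Lam : 'I_p -> probability (zvec p) R) (M : 'M[R]_p).
Hypothesis LamI : forall i j,
  (Lam i).-integrable setT (fun x => ((x j 0)%:R : R)%:E).
Hypothesis ME : forall i j, M i j = expect (Lam i) (fun x => (x j 0)%:R).
Variable Gam : probability (zvec p) R.
Let f := offspring_pgf Lam.
Let g (s : 'I_p -> R) := expect Gam (monomial s).
Let sat (i : 'I_p) (u : R) (x : zvec p) := saturate ((x i 0)%:R * u).

Let sat_itv i u x : 0 <= u -> 0 <= sat i u x <= 1.
Proof. by move=> u0; rewrite /sat saturate_ge0 ?saturate_le1// mulr_ge0. Qed.

Let sat_bounded i u : 0 <= u -> is_bounded (sat i u).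
Proof. by move=> u0; apply: unit_is_bounded => x; exact: sat_itv. Qed.

Let expect_sat_itv i u : 0 <= u -> 0 <= expect Gam (sat i u) <= 1.
Proof.
by move=> u0; apply: (mean_itv (expect_mean Gam)) => x; exact: sat_itv.
Qed.

Lemma onem_innovation_pgf_le (s u : 'I_p -> R) : (forall i, 0 <= s i <= 1) ->
  (forall i, 1 - s i <= u i) ->
  1 - g s <= 2 * \sum_(i < p) expect Gam (fun x => saturate ((x i 0)%:R * u i)).
Proof.
move=> s01 su; have u0 i : 0 <= u i.
  by have /andP[_ s1] := s01 i; rewrite (le_trans _ (su i))// subr_ge0.
have sB : is_bounded (fun x => \sum_(i < p) sat i (u i) x).
  by apply: is_bounded_sum => i; exact: sat_bounded.
rewrite /g -(mean_onem (expect_mean _)); last exact: monomial_is_bounded.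
rewrite -(mean_sum (expect_mean Gam)); last by move=> i; exact: sat_bounded.
rewrite -expectZ//; apply: expect_le; last 2 first.
- exact: is_boundedZ.
- move=> x; apply: (le_trans (onem_monomial_le _ _ s01)).
  rewrite mulr_sumr; apply: ler_sum => i _; have /andP[s0 s1] := s01 i.
  have e01 : 0 <= 1 - s i <= 1 by lra.
  have := onem_expr_le_saturate _ _ (x i 0) e01; rewrite subKr => /le_trans; apply.
  rewrite ler_wpM2l//; apply: saturate_mono; last by rewrite ler_wpM2l.
  by rewrite mulr_ge0// subr_ge0.
exact: onem_monomial_is_bounded.
Qed.

(** Dominated convergence: [saturate (x u)] is at most 1 and tends to 0 with [u]. This controls the
    finitely many terms in which types outside [I] still contribute. *)
Lemma expect_saturate_small e : 0 < e -> exists2 u, 0 < u &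
  \sum_(i < p) expect Gam (sat i u) <= e.
Proof.
move=> e0; pose u (n : nat) : R := n.+1%:R^-1.
have u0 n : 0 <= u n by rewrite invr_ge0.
have satE n : \sum_(i < p) expect Gam (sat i (u n)) =
    expect Gam (fun x => \sum_(i < p) sat i (u n) x).
  by rewrite (mean_sum (expect_mean Gam)) => // i; exact: sat_bounded.
have : expect Gam (fun x => \sum_(i < p) sat i (u n) x) @[n --> \oo] -->
    expect Gam (fun=> 0).
  apply: (@expect_dominated_cvg _ _ _ _ _ p%:R) => [n x|x].
    rewrite ger0_norm; last first.
      by apply: sumr_ge0 => i _; have /andP[] := sat_itv i _ x (u0 n).
    rewrite -[p in leRHS]card_ord -sumr_const; apply: ler_sum => i _.
    by have /andP[] := sat_itv i _ x (u0 n).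
  apply: (squeeze_cvgr _ (cvg_cst 0)
    (h := fun n => \sum_(i < p) (x i 0)%:R * u n)).
  - apply: nearW => n; apply/andP; split.
      by apply: sumr_ge0 => i _; have /andP[] := sat_itv i _ x (u0 n).
    by apply: ler_sum => i _; apply: saturate_le; rewrite mulr_ge0.
  - rewrite (_ : (fun n => _) = (fun n => (\sum_(i < p) (x i 0)%:R) * u n)).
      rewrite -[X in _ --> X](mulr0 (\sum_(i < p) (x i 0)%:R)).
      by apply: cvgMr; exact: cvg_harmonic.
    by apply/funext => n; rewrite mulr_suml.
rewrite expect_cst => /cvgrPdist_le /(_ e e0)[n _ /(_ n (leqnn n))].
rewrite /= sub0r normrN -satE => /ler_normlW H.
by exists (u n) => //; rewrite invr_gt0.
Qed.

Lemma sum_expect_saturate_bounded i (D r : R) : 0 <= D -> 0 < r < 1 ->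
  (\int[Gam]_x (ln ((x i 0)%:R : R))%:E < +oo)%E ->
  exists B, forall n, \sum_(k < n) expect Gam (sat i (D * r ^+ k)) <= B.
Proof.
move=> D0 r01 lnI; have /andP[r0 r1] := r01.
have Dr0 k : 0 <= D * r ^+ k by rewrite mulr_ge0// exprn_ge0// ltW.
have ln0' k : 0 <= ln (k%:R : R) by exact: ln_nat_ge0.
(* Dominates the partial sums: they are at most [(1 - r)^-1 ln (1 + x D)], and
   [1 + x D <= (1 + D) x] for [x >= 1]. At [x = 0] the convention [ln 0 = 0] keeps [G]
   nonnegative. *)
pose G (x : zvec p) : R := (1 - r)^-1 * (ln (1 + D) + ln (x i 0)%:R).
have lnD0 : 0 <= ln (1 + D) by rewrite ln_ge0// lerDl.
have GI : (\int[Gam]_x (G x)%:E < +oo)%E.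
  under eq_integral do rewrite /G EFinM EFinD.
  have r1' : 0 <= (1 - r)^-1 by rewrite invr_ge0 subr_ge0 ltW.
  rewrite ge0_integralZl_EFin//; last first.
    by move=> x _; rewrite adde_ge0 ?lee_fin.
  rewrite ge0_integralD//; try by move=> x _; rewrite ?lee_fin.
  apply: lte_mul_pinfty => //.
  rewrite lte_add_pinfty// integral_cst//.
  apply: (@le_lt_trans _ _ ((ln (1 + D))%:E * 1)%E); last by rewrite mule1 ltry.
  by apply: lee_wpmul2l; [rewrite lee_fin|exact: probability_le1].
exists (fine (\int[Gam]_x (G x)%:E)%E) => n.
have sB k : is_bounded (sat i (D * r ^+ k)) by exact: sat_bounded.
rewrite -(mean_sum (expect_mean Gam))// -lee_fin.
rewrite EFin_expect; last exact: is_bounded_sum.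
rewrite fineK; last first.
  rewrite ge0_fin_numE//; apply: integral_ge0 => x _.
  by rewrite lee_fin mulr_ge0 ?addr_ge0// invr_ge0 subr_ge0 ltW.
apply: ge0_le_integral => //.
  move=> x _; rewrite lee_fin sumr_ge0// => k _.
  by have /andP[] := sat_itv i _ x (Dr0 k).
move=> x _; rewrite lee_fin.
have xD0 : 0 <= (x i 0)%:R * D by rewrite mulr_ge0.
rewrite (eq_bigr (fun k : 'I_n => saturate ((x i 0)%:R * D * r ^+ k))); last first.
  by move=> k _; rewrite /sat mulrA.
apply: (le_trans (sum_saturate_le_ln _ _ _ n r01 xD0)).
rewrite /G ler_wpM2l ?invr_ge0 ?subr_ge0 ?(ltW r1)//.
have [->|x0] := posnP (x i 0); first by rewrite mul0r addr0 ln1 addr_ge0.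
have x1 : 1 <= (x i 0)%:R :> R by rewrite ler1n.
rewrite -lnM ?posrE; [|lra|lra].
by rewrite ler_ln ?posrE; nra.
Qed.

(** The order of choices matters: the cut [N] comes from a convergent series [T] that does not
    involve [t], and then [t] is chosen close enough to 1 for the terms below [N]. *)
Lemma sum_onem_innovation_pgf_small (C r : R) : 0 <= C -> 0 < r < 1 ->
  (forall n i j, `|(M ^+ n) i j| <= C * r ^+ n) ->
  (forall i, leads_to_cycle M i ->
     (\int[Gam]_x (ln ((x i 0)%:R : R))%:E < +oo)%E) ->
  forall e, 0 < e -> exists2 t, 0 <= t < 1 &
    forall n, \sum_(k < n) (1 - g (iter k f (fun=> t))) <= e.
Proof.
move=> C0 r01 CrP lnI e e0; have /andP[r0 r1] := r01.
(* A row of [M^k] has [p] entries, each at most [C r^k]. *)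
pose D := C * p%:R; have D0 : 0 <= D by rewrite mulr_ge0.
have Dr0 k : 0 <= D * r ^+ k by rewrite mulr_ge0// exprn_ge0// ltW.
have iter_le t k i : 0 <= t <= 1 ->
    1 - iter k f (fun=> t) i <= D * r ^+ k * (1 - t).
  move=> /andP[t0 t1]; apply: (le_trans (onem_iter_pgf_le _ _ LamI ME _ _ _ _)).
    by move=> _; rewrite t0.
  rewrite -mulr_suml ler_wpM2r ?subr_ge0//.
  rewrite /D mulrAC -[p in leRHS]card_ord mulr_natr -sumr_const.
  by apply: ler_sum => j _; apply: le_trans (CrP k i j); exact: ler_norm.
pose T k :=
  \sum_(i < p | `[< leads_to_cycle M i >]) expect Gam (sat i (D * r ^+ k)).
have T0 k : 0 <= T k.
  by apply: sumr_ge0 => i _; have /andP[] := expect_sat_itv i _ (Dr0 k).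
have [B BP] : exists B, forall n, \sum_(k < n) T k <= B.
  have H i : exists B, leads_to_cycle M i -> forall n,
      \sum_(k < n) expect Gam (sat i (D * r ^+ k)) <= B.
    have [iI|iI] := pselect (leads_to_cycle M i); last by exists 0.
    have [B BP] := sum_expect_saturate_bounded i D r D0 r01 (lnI i iI).
    by exists B.
  have /choice[B BP] := H.
  exists (\sum_(i < p | `[< leads_to_cycle M i >]) B i) => n.
  by rewrite exchange_big/=; apply: ler_sum => i /asboolP iI; exact: BP.
have e4 : 0 < e / 4 by rewrite divr_gt0.
have [N0 N0P] := nonneg_series_tail _ _ _ T0 BP _ e4.
(* Beyond [p] only the types that lead to a cycle contribute; beyond [N0] the tail of [T] is at most
   [e / 4]. *)
pose N := maxn p N0.
have eN : 0 < e / (4 * N.+1%:R) by rewrite divr_gt0// mulr_gt0.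
have [u u0 uP] := expect_saturate_small _ eN.
(* [q] is [1 - t]: the minimum keeps [t] nonnegative, and [D + 1] avoids a division by 0 while still
   giving [D q <= u]. *)
pose q := Num.min 1 (u / (D + 1)).
have uD0 : 0 < u / (D + 1) by rewrite divr_gt0//; lra.
have q0 : 0 < q by rewrite lt_min ltr01.
have q1 : q <= 1 by rewrite ge_min lexx.
have Dq : D * q <= u.
  apply: (@le_trans _ _ (D * (u / (D + 1)))).
    by rewrite ler_wpM2l// ge_min lexx orbT.
  by rewrite mulrA ler_pdivrMr; nra.
have t01 : 0 <= 1 - q <= 1 by lra.
exists (1 - q) => [|n]; first by lra.
have t01' : forall i : 'I_p, 0 <= (fun=> 1 - q) i <= 1 by [].
have it01 k := iter_pgf_itv Lam _ k t01'.
have head k : 1 - g (iter k f (fun=> 1 - q)) <= 2 * (e / (4 * N.+1%:R)).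
  apply: (le_trans (onem_innovation_pgf_le _ (fun=> u) (it01 k) _)).
    move=> i; apply: (le_trans (iter_le _ k i t01)); rewrite subKr.
    apply: le_trans Dq; rewrite mulrAC ler_piMr ?mulr_ge0 ?(ltW q0)//.
    by rewrite exprn_ile1// ltW.
  by rewrite ler_wpM2l.
have tail k : (p <= k)%N -> 1 - g (iter k f (fun=> 1 - q)) <= 2 * T k.
  (* For a type that leads to no cycle the row of [M^k] is zero, so 0 bounds [1 - f^k_i] and the
     corresponding [saturate] term drops out. *)
  move=> pk; pose v i := if `[< leads_to_cycle M i >] then D * r ^+ k else 0.
  apply: (le_trans (onem_innovation_pgf_le _ v (it01 k) _)).
    move=> i; rewrite /v; case: asboolP => iI.
      apply: (le_trans (iter_le _ k i t01)); rewrite subKr ler_piMr//.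
    apply: (le_trans (onem_iter_pgf_le _ _ LamI ME _ _ _ t01')).
    rewrite big1// => j _; rewrite mxpow_eq0_notin_cycle ?mul0r//.
    by move=> a b; exact: (mean_matrix_ge0 _ _ ME).
  rewrite ler_wpM2l// /T [leRHS]big_mkcond/=; apply: ler_sum => i _.
  rewrite /v; case: asboolP => // _.
  rewrite (_ : (fun x => _) = fun=> 0) ?expect_cst//.
  by apply/funext => x; rewrite mulr0 /saturate mul0r.
have g1 k : 0 <= 1 - g (iter k f (fun=> 1 - q)).
  by rewrite subr_ge0; have /andP[] := expect_monomial_itv _ _ Gam _ (it01 k).
(* Lengthening the sum lets it be split at [N] whatever [n] is. *)
apply: (@le_trans _ _ (\sum_(k < N + n) (1 - g (iter k f (fun=> 1 - q))))).
  rewrite -(big_mkord xpredT (fun k => 1 - g (iter k f _))).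
  rewrite -(big_mkord xpredT (fun k => 1 - g (iter k f _))).
  by rewrite [leRHS](big_cat_nat (leq0n n))/= ?leq_addl// lerDl sumr_ge0.
rewrite -(big_mkord xpredT (fun k => 1 - g (iter k f _))).
rewrite (big_cat_nat (leq0n N))/= ?leq_addr//.
have h1 : \sum_(0 <= k < N) (1 - g (iter k f (fun=> 1 - q))) <= e / 2.
  apply: (@le_trans _ _ (\sum_(0 <= k < N) (2 * (e / (4 * N.+1%:R))))).
    by apply: ler_sum => k _.
  rewrite big_mkord sumr_const card_ord -[_ *+ N]mulr_natr.
  have N1 : 0 < N.+1%:R :> R by [].
  have : N%:R / N.+1%:R <= 1 :> R by rewrite ler_pdivrMr// mul1r ler_nat.
  move: N.+1%:R N1 => L L0 NL.
  have -> : 2 * (e / (4 * L)) * N%:R = e / 2 * (N%:R / L).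
    by field; rewrite gt_eqF.
  by rewrite ler_piMr// divr_ge0// ltW.
have h2 : \sum_(N <= k < N + n) (1 - g (iter k f (fun=> 1 - q))) <= 2 * (e / 4).
  apply: (@le_trans _ _ (\sum_(N <= k < N + n) 2 * T k)).
    rewrite !big_nat; apply: ler_sum => k /andP[Nk _]; apply: tail.
    by rewrite (leq_trans _ Nk)// leq_maxl.
  by rewrite -mulr_sumr ler_wpM2l// N0P// leq_maxr.
clear t01'; lra.
Qed.

End Immigration.

(** * Iterates of the transition operator *)

Definition atom {R : realType} {p : nat} (k : nat) (x : zvec p) : R :=
  (zcode x == k)%:R.

Definition initial {R : realType} {p : nat} (N : nat) (x : zvec p) : R :=
  (zcode x < N)%N%:R.

Section Atoms.
Context {R : realType} {p : nat}.
Implicit Types phi : zvec p -> R.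

Lemma atom_bounded k : is_bounded (@atom R p k).
Proof.
by apply: unit_is_bounded => x; rewrite /atom; case: eqP; rewrite ?lexx ?ler01.
Qed.

Lemma initial_itv N x : 0 <= @initial R p N x <= 1.
Proof. by rewrite /initial; case: ltnP; rewrite ?lexx ?ler01. Qed.

Lemma initial_bounded N : is_bounded (@initial R p N).
Proof. by apply: unit_is_bounded => x; exact: initial_itv. Qed.

Lemma initial_atoms phi N x :
  phi x * initial N x = \sum_(k < N) phi (zdecode k) * atom k x.
Proof.
rewrite /initial /atom; case: ltnP => xN.
  rewrite (bigD1 (Ordinal xN))//= zcodeK eqxx big1 ?addr0// => k.
  by rewrite -val_eqE /= eq_sym => /negbTE ->; rewrite mulr0.
rewrite mulr0 big1// => k _; rewrite (_ : _ == _ = false) ?mulr0//.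
by apply/negP => /eqP xk; move: xN; rewrite xk leqNgt ltn_ord.
Qed.

(** On the first [N] states [phi] is a finite combination of atoms; elsewhere it lies between 0 and
    1, and the mass there is at most [e]. *)
Lemma mean_atoms_approx (L : (zvec p -> R) -> R) phi N e :
  mean_functional L -> (forall x, 0 <= phi x <= 1) ->
  1 - e <= L (initial N) ->
  \sum_(k < N) phi (zdecode k) * L (atom k) <= L phi <=
  \sum_(k < N) phi (zdecode k) * L (atom k) + e.
Proof.
move=> meanL phi01 Le; have phiB := unit_is_bounded _ _ _ phi01.
have sumE : \sum_(k < N) phi (zdecode k) * L (atom k) =
    L (fun x => phi x * initial N x).
  rewrite (_ : (fun x => _) = fun x => \sum_(k < N) phi (zdecode k) * atom k x).
    rewrite (mean_sum meanL) => [|k]; last by apply: is_boundedZ; exact: atom_bounded.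
    by apply: eq_bigr => k _; rewrite (meanZ meanL)//; exact: atom_bounded.
  by apply/funext => x; exact: initial_atoms.
have phi_i01 x : 0 <= phi x * initial N x <= 1.
  have /andP[a0 a1] := phi01 x; have /andP[b0 b1] := initial_itv N x.
  by rewrite mulr_ge0// mulr_ile1.
have piB := unit_is_bounded _ _ _ phi_i01.
rewrite sumE; apply/andP; split.
  apply: (mean_le meanL) => // x; have /andP[a0 a1] := phi01 x.
  by have /andP[b0 b1] := initial_itv N x; rewrite ler_piMr.
apply: (@le_trans _ _ (L (fun x => phi x * initial N x + (1 - initial N x)))).
  apply: (mean_le meanL) => //.
    apply: is_boundedD => //; apply: unit_is_bounded => x.
    by have /andP[? ?] := initial_itv N x; lra.
  by move=> x; have := phi01 x; have := initial_itv N x; nra.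
rewrite (meanD meanL)//; last first.
  by apply: unit_is_bounded => x; have /andP[? ?] := initial_itv N x; lra.
rewrite lerD2l (mean_onem meanL); last exact: initial_bounded.
by rewrite lerBlDr addrC -lerBlDr.
Qed.

(** A box is finite. This converts bounds on coordinates, which generating functions provide, into
    bounds on codes, in which tightness is stated. *)
Lemma box_code_bounded (N : nat) : exists m, forall x : zvec p,
  (forall i, (x i 0%R <= N)%N) -> (zcode x < m)%N.
Proof.
pose col (h : {ffun 'I_p -> 'I_N.+1}) : zvec p := \col_i (h i : nat).
exists (\max_(h : {ffun 'I_p -> 'I_N.+1}) zcode (col h)).+1 => x xN.
rewrite ltnS; have -> : x = col [ffun i => inord (x i 0)].
  by apply/matrixP => i j; rewrite !mxE ffunE inordK ?(ord1 j)//; exact: xN.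
exact: leq_bigmax.
Qed.

Definition below (z x : zvec p) : R := `[< zle x z >]%:R.
Definition strictly_below (z x : zvec p) : R := `[< zle x z /\ x <> z >]%:R.

Lemma zle_anti (x y : zvec p) : zle x y -> zle y x -> x = y.
Proof.
move=> xy yx; apply/matrixP => i j; rewrite (ord1 j).
by apply/eqP; rewrite eqn_leq xy yx.
Qed.

Lemma zle_trans (x y z : zvec p) : zle x y -> zle y z -> zle x z.
Proof. by move=> xy yz i; exact: leq_trans (xy i) (yz i). Qed.

Lemma indicator_itv (A : Prop) : 0 <= (`[< A >]%:R : R) <= 1.
Proof. by case: asboolP; rewrite ?lexx ?ler01. Qed.

Lemma indicator_le (A B : Prop) : (A -> B) -> (`[< A >]%:R : R) <= `[< B >]%:R.
Proof.
by move=> AB; case: (asboolP A) => [/AB/asboolP -> //|_]; case: asboolP.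
Qed.

Lemma below_antitone z : antitone (below z).
Proof. by move=> x y xy; apply: indicator_le; exact: zle_trans. Qed.

Lemma strictly_below_antitone z : antitone (strictly_below z).
Proof.
move=> x y xy; apply: indicator_le => -[yz nyz]; split.
  exact: zle_trans yz.
by move=> xz; apply: nyz; apply: zle_anti => //; rewrite -xz.
Qed.

Lemma atom_below z x : atom (zcode z) x = below z x - strictly_below z x.
Proof.
rewrite /atom /below /strictly_below; case: eqP => [/(can_inj (@zcodeK p)) ->|xz].
  rewrite (_ : `[< zle z z >] = true); last by apply/asboolP => i.
  by rewrite (_ : `[< _ >] = false) ?subr0//; apply/asboolP => -[].
rewrite (_ : `[< zle x z /\ x <> z >] = `[< zle x z >]) ?subrr//.
by apply: asbool_equiv_eq; split=> [[]//|h]; split=> // xE; apply: xz; rewrite xE.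
Qed.

End Atoms.

Section Iterates.
Context {R : realType} {p : nat}.
Variable K : zvec p -> probability (zvec p) R.
Implicit Types phi psi : zvec p -> R.

(** The Markov operator: [iter n T phi x] is the mean of [phi] after [n] steps from [x]. *)
Definition average phi : zvec p -> R := fun x => expect (K x) phi.

Let T := average.

Lemma iter_average_bounded phi n : is_bounded phi -> is_bounded (iter n T phi).
Proof.
move=> [B phiB]; exists B; elim: n => [//|n IH] x.
by rewrite iterS; apply: (mean_norm_le (expect_mean _)).
Qed.

Lemma iter_average_mean n x : mean_functional (fun phi => iter n T phi x).
Proof.
elim: n x => [|n IH] x; first by split => // phi psi ? ? h; exact: h.
have b := iter_average_bounded.
split=> [phi psi B1 B2|c phi B1|c|phi psi B1 B2 h]; rewrite !iterS /T /average -/T.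
- rewrite -expectD; [|exact: b..].
  by congr expect; apply/funext => y; exact: (meanD (IH y)).
- rewrite -expectZ; last exact: b.
  by congr expect; apply/funext => y; exact: (meanZ (IH y)).
- rewrite -[RHS](expect_cst (K x)).
  by congr expect; apply/funext => y; exact: (mean_cst (IH y)).
- by apply: expect_le; [exact: b..|move=> y; exact: (mean_le (IH y))].
Qed.

Section Antitone.
Hypothesis K_antitone : forall phi, (forall x, 0 <= phi x <= 1) ->
  antitone phi -> antitone (fun x => expect (K x) phi).

Lemma iter_average_itv phi n x : (forall x, 0 <= phi x <= 1) ->
  0 <= iter n T phi x <= 1.
Proof. by move=> phi01; exact: (mean_itv (iter_average_mean n x)). Qed.

Lemma iter_average_antitone phi n : (forall x, 0 <= phi x <= 1) ->
  antitone phi -> antitone (iter n T phi).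
Proof.
move=> phi01 phia; elim: n => [//|n IH]; rewrite iterS.
by apply: K_antitone => // x; exact: iter_average_itv.
Qed.

(** The state 0 is the least one, so an antitone function has mean at most its value at 0. Applied
    to [iter n T phi], this makes the sequence nonincreasing. *)
Lemma iter_average_is_cvg phi : (forall x, 0 <= phi x <= 1) -> antitone phi ->
  cvgn (fun n => iter n T phi 0).
Proof.
move=> phi01 phia; apply: nonincreasing_is_cvgn; last first.
  by exists 0 => _ [n _ <-]; have /andP[] := iter_average_itv _ n 0 phi01.
apply/nonincreasing_seqP => n; rewrite iterS /T /average -/T.
rewrite -[leRHS](expect_cst (K 0)); apply: expect_le.
- by apply: iter_average_bounded; exact: unit_is_bounded.
- exact: is_bounded_cst.
- by move=> x; apply: iter_average_antitone => // i; rewrite mxE.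
Qed.

(* Indicators of states are differences of antitone functions. *)
Lemma iter_average_atom_is_cvg k : cvgn (fun n => iter n T (atom k) 0).
Proof.
have [kE|kE] := eqVneq (zcode (zdecode k : zvec p)) k; last first.
  rewrite (_ : atom k = fun=> 0); last first.
    apply/funext => x; rewrite /atom; case: eqP => // xk.
    by move: kE; rewrite -xk zcodeK eqxx.
  rewrite (_ : (fun n => _) = fun=> 0); first exact: is_cvg_cst.
  by apply/funext => n; exact: (mean_cst (iter_average_mean n 0)).
rewrite -kE; set z := zdecode k.
have bB : is_bounded (below z : zvec p -> R).
  by apply: unit_is_bounded => x; exact: indicator_itv.
have sB : is_bounded (strictly_below z : zvec p -> R).
  by apply: unit_is_bounded => x; exact: indicator_itv.
rewrite (_ : (fun n => _) =
    fun n => iter n T (below z) 0 - iter n T (strictly_below z) 0).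
  apply: is_cvgB; apply: iter_average_is_cvg => [x|]; rewrite ?indicator_itv//.
    exact: below_antitone.
  exact: strictly_below_antitone.
apply/funext => n; have m := iter_average_mean n 0.
rewrite -mulN1r -(meanZ m)// -(meanD m)//; last exact: is_boundedZ.
by congr (iter n T _ 0); apply/funext => x; rewrite mulN1r atom_below.
Qed.

End Antitone.

Section Tight.
Variables (Lam : 'I_p -> probability (zvec p) R) (Gam : probability (zvec p) R).
Let f := offspring_pgf Lam.
Let g (s : 'I_p -> R) := expect Gam (monomial s).
Hypothesis K_pgf : forall s, (forall i, 0 <= s i <= 1) -> forall x,
  expect (K x) (monomial s) = monomial (f s) x * g s.

(** The innermost application turns [s^x] into [g(s) f(s)^x], a multiple of a monomial again, so the
    induction runs over all [s]. *)
Lemma iter_average_monomial s n x : (forall i, 0 <= s i <= 1) ->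
  iter n T (monomial s) x =
  monomial (iter n f s) x * \prod_(k < n) g (iter k f s).
Proof.
elim: n s x => [|n IH] s x s01; first by rewrite big_ord0 mulr1.
rewrite iterSr (_ : T (monomial s) = fun y => g s * monomial (f s) y); last first.
  by apply/funext => y; rewrite /T /average K_pgf// mulrC.
have fs01 := iter_pgf_itv Lam s 1 s01.
rewrite (meanZ (iter_average_mean n x)); last exact: monomial_is_bounded.
rewrite IH// iterSr big_ord_recl /= mulrCA; congr (_ * (_ * _)).
by apply: eq_bigr => k _; rewrite -iterSr.
Qed.

(** A Markov-type inequality: outside the box of side [N] some coordinate exceeds [N], so
    [s^x <= t^N <= 1/2] and the indicator of the complement is at most [2 (1 - s^x)]. *)
Lemma iter_average_tight :
  (forall e, 0 < e -> exists2 t, 0 <= t < 1 &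
     forall n, \sum_(k < n) (1 - g (iter k f (fun=> t))) <= e) ->
  forall e, 0 < e -> exists m, forall n, 1 - e <= iter n T (initial m) 0.
Proof.
move=> small e e0; have e2 : 0 < e / 2 by rewrite divr_gt0.
have [t /andP[t0 t1] tP] := small _ e2.
pose h := (fun=> t) : 'I_p -> R.
have h01 i : 0 <= h i <= 1 by rewrite /h t0 ltW.
have [N NP] : exists N, t ^+ N <= 2^-1.
  have : (fun n => t ^+ n) @ \oo --> (0 : R) by apply: cvg_expr; rewrite ger0_norm.
  have h2 : 0 < 2^-1 :> R by rewrite invr_gt0.
  move=> /cvgrPdist_le /(_ _ h2)[N _ /(_ N (leqnn N))].
  by rewrite /= sub0r normrN => /ler_normlW H; exists N.
have [m mP] := @box_code_bounded p N.
exists m => n; have mean := iter_average_mean n 0.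
have gn : 1 - e / 2 <= iter n T (monomial h) 0.
  rewrite iter_average_monomial// monomial0 mul1r.
  have := onem_prod_le R _ (index_enum 'I_n) (fun k : 'I_n => g (iter k f h)).
  have gi k : 0 <= g (iter k f h) <= 1.
    by apply: expect_monomial_itv; exact: iter_pgf_itv.
  by move=> /(_ (fun k => gi _)); have := tP n; rewrite -/h; lra.
have imB : is_bounded (initial m : zvec p -> R) := initial_bounded m.
have hB : is_bounded (monomial h) by exact: monomial_is_bounded.
have : iter n T (fun x => 1 - initial m x) 0 <=
    iter n T (fun x => 2 * (1 - monomial h x)) 0.
  have hB' : is_bounded (fun x => 1 - monomial h x).
    exact: onem_monomial_is_bounded.
  apply: (mean_le mean).
  - apply: unit_is_bounded => x.
    by have /andP[? ?] := @initial_itv R p m x; lra.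
  - exact: is_boundedZ.
  move=> x; have /andP[m0 m1] := monomial_itv _ x h01.
  rewrite /initial; case: ltnP => xm /=; rewrite ?mulr1n ?mulr0n; first by lra.
  have [i iN] : exists i, (N < x i 0%R)%N.
    apply: contrapT => /forallNP H; move: xm; rewrite leqNgt mP// => i.
    by rewrite leqNgt; apply/negP; exact: H.
  have := monomial_le _ x i h01; rewrite /h.
  have : t ^+ x i 0 <= t ^+ N by rewrite ler_wiXn2l ?(ltW t1)// ltnW.
  by lra.
rewrite (mean_onem mean)// (meanZ mean) ?(mean_onem mean)//; last first.
  exact: onem_monomial_is_bounded.
by lra.
Qed.

End Tight.
End Iterates.

(** * The limit law *)

Section DiscreteLaw.
Context {R : realType} {p : nat}.
Variable a : {nonneg R}^nat.

(* The normalization is an argument so that it can be recovered from the term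
   when a probability structure is inferred. *)
Definition discrete_law
    of (\sum_(0 <= k <oo) (a k)%:num%:E = 1)%E : set (zvec p) -> \bar R :=
  mseries (fun k => mscale (a k) (dirac (zdecode k : zvec p))) 0.

HB.instance Definition _ a1 := Measure.on (discrete_law a1).

Let discrete_law_setT a1 : discrete_law a1 setT = 1%E.
Proof.
rewrite /discrete_law /mseries -[RHS]a1; apply: eq_eseriesr => k _.
by rewrite -[LHS]/((a k)%:num%:E * dirac (zdecode k : zvec p) setT)%E diracT mule1.
Qed.

HB.instance Definition _ a1 :=
  Measure_isProbability.Build _ _ _ (discrete_law a1) (discrete_law_setT a1).

Lemma integral_discrete_law a1 (phi : zvec p -> R) : (forall x, 0 <= phi x) ->
  (\int[discrete_law a1]_x (phi x)%:E =
   \sum_(0 <= k <oo) ((a k)%:num * phi (zdecode k))%:E)%E.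
Proof.
move=> phi0.
rewrite ge0_integral_measure_series//; last by move=> x _; rewrite lee_fin.
apply: eq_eseriesr => k _.
rewrite ge0_integral_mscale//; last by move=> x _; rewrite lee_fin.
by rewrite integral_dirac// diracT mul1e EFinM.
Qed.

End DiscreteLaw.

(** The limits of the point masses have total at most 1 in general; tightness rules out a loss of
    mass, and then upgrades convergence on atoms to all [phi] with values in [[0, 1]]. *)
Lemma limit_law (R : realType) (p : nat) (L : nat -> (zvec p -> R) -> R) :
  (forall n, mean_functional (L n)) ->
  (forall k, cvgn (fun n => L n (atom k))) ->
  (forall e, 0 < e -> exists m, forall n, 1 - e <= L n (initial m)) ->
  exists Q : probability (zvec p) R, forall phi, (forall x, 0 <= phi x <= 1) ->
    L n phi @[n --> \oo] --> expect Q phi.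
Proof.
move=> meanL cvgL tightL.
have atom01 k (x : zvec p) : 0 <= (atom k x : R) <= 1.
  by rewrite /atom; case: eqP; rewrite ?lexx ?ler01.
pose b k := limn (fun n => L n (atom k)).
have b0 k : 0 <= b k.
  apply: limr_ge; first exact: cvgL.
  by apply: nearW => n; have /andP[] := mean_itv (meanL n) _ (atom01 k).
have sumL N : L n (initial N) @[n --> \oo] --> \sum_(k < N) b k.
  rewrite (_ : (fun n => _) = fun n => \sum_(k < N) L n (atom k)).
    by apply: cvg_big => [|k _]; [exact: add_continuous|exact: cvgL].
  apply/funext => n; rewrite -(mean_sum (meanL n)); last by move=> k; exact: atom_bounded.
  congr (L n); apply/funext => x; rewrite -[LHS]mul1r.
  by rewrite (initial_atoms (fun=> 1)); apply: eq_bigr => k _; rewrite mul1r.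
have sum_le1 N : \sum_(k < N) b k <= 1.
  rewrite -(cvg_lim _ (sumL N))//; apply: limr_le.
    by apply/cvg_ex; eexists; exact: sumL.
  by apply: nearW => n; have /andP[] := mean_itv (meanL n) _ (initial_itv N).
have sum_ge e : 0 < e -> exists m, (forall n, 1 - e <= L n (initial m)) /\
    1 - e <= \sum_(k < m) b k.
  move=> e0; have [m mP] := tightL e e0; exists m; split=> //.
  rewrite -(cvg_lim _ (sumL m))//; apply: limr_ge.
    by apply/cvg_ex; eexists; exact: sumL.
  exact: nearW.
pose a k : {nonneg R} := NngNum (b0 k).
have a1 : (\sum_(0 <= k <oo) (a k)%:num%:E = 1)%E.
  apply: cvg_lim => //.
  rewrite (_ : (fun n => _) = EFin \o (fun n => \sum_(k < n) b k)); last first.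
    by apply/funext => n /=; rewrite sumEFin big_mkord.
  apply: cvg_EFin; first exact: nearW.
  apply/cvgrPdist_le => e e0; have [m [_ mP]] := sum_ge e e0.
  exists m => // n /= mn; rewrite ger0_norm; last by rewrite subr_ge0; exact: sum_le1.
  rewrite lerBlDr addrC -lerBlDr (le_trans mP)//.
  rewrite -!(big_mkord xpredT b) [leRHS](big_cat_nat (leq0n m) mn)/=.
  by rewrite lerDl sumr_ge0.
pose Q : probability (zvec p) R := discrete_law a a1.
have Qatom k : expect Q (atom k) = b k.
  apply: EFin_inj; rewrite EFin_expect; last exact: atom_bounded.
  rewrite (integral_discrete_law a); last first.
    by move=> x; have /andP[] := atom01 k x.
  (* [zdecode] sends every non-code to the state 0, where it could add spurious mass; but [atom j]
     is then the zero function, so [b j = 0]. *)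
  have termE j : b j * atom k (zdecode j : zvec p) = if j == k then b k else 0.
    have [jE|jE] := eqVneq (zcode (zdecode j : zvec p)) j.
      by rewrite /atom jE; case: eqP => [->|_]; rewrite ?mulr1 ?mulr0.
    have bj : b j = 0.
      apply: lim_near_cst => //; apply: nearW => n.
      rewrite -[RHS](mean_cst (meanL n)); congr (L n); apply/funext => x.
      by rewrite /atom; case: eqP => // xj; move: jE; rewrite -xj zcodeK eqxx.
    by rewrite bj mul0r; case: eqP => // <-.
  apply: lim_near_cst => //; exists k.+1 => // n /= kn.
  rewrite sumEFin big_mkord (bigD1 (Ordinal kn))//= big1 ?addr0.
    by rewrite termE eqxx.
  by move=> j; rewrite -val_eqE /= => /negbTE jk; rewrite termE jk.
exists Q => phi phi01; have phiB := unit_is_bounded _ _ _ phi01.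
apply/cvgrPdist_le => e e0; have e2 : 0 < e / 2 by rewrite divr_gt0.
have [m [mL mb]] := sum_ge _ e2.
have mQ : 1 - e / 2 <= expect Q (initial m).
  rewrite (_ : initial m = fun x => \sum_(k < m) atom k x).
    rewrite (mean_sum (expect_mean Q)); last by move=> k; exact: atom_bounded.
    by under eq_bigr do rewrite Qatom.
  apply/funext => x; rewrite -[LHS]mul1r (initial_atoms (fun=> 1)).
  by apply: eq_bigr => k _; rewrite mul1r.
(* Both means exceed their sums over the first [m] states by an amount between 0 and [e / 2], and
   for large [n] these sums differ by at most [e / 2]. *)
have := mean_atoms_approx _ _ _ _ (expect_mean Q) phi01 mQ.
under eq_bigr do rewrite Qatom.
set S := \sum_(k < m) _ => /andP[Q1 Q2].
have cvgS : \sum_(k < m) phi (zdecode k) * L n (atom k) @[n --> \oo] --> S.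
  apply: cvg_big => [|k _]; first exact: add_continuous.
  by apply: cvgMr; exact: cvgL.
move/cvgrPdist_le : cvgS => /(_ _ e2) cvgS; near=> n.
have : `|S - \sum_(k < m) phi (zdecode k) * L n (atom k)| <= e / 2 by near: n.
have /andP[] := mean_atoms_approx _ _ _ _ (meanL n) phi01 (mL n).
rewrite !ler_norml; lra.
Unshelve. all: end_near. Qed.

(** * Stationarity of the limit and its form for functions *)

Lemma expect_indic (R : realType) (p : nat) (Q : probability (zvec p) R)
    (B : set (zvec p)) : Q B = (expect Q \1_B)%:E.
Proof.
rewrite EFin_expect ?integral_indic ?setIT//.
apply: unit_is_bounded => x.
by rewrite indicE; case: (_ \in _); rewrite ?lexx ?ler01.
Qed.

(** Convergence holds for [T 1_B] as well as for [1_B], and [T^n (T 1_B)] is the shifted sequence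
    [T^(n+1) 1_B]; the two limits at 0 agree. *)
Lemma exists_stationary_law (R : realType) (p : nat)
    (K : zvec p -> probability (zvec p) R) :
  (forall k, cvgn (fun n => iter n (average K) (atom k) 0)) ->
  (forall e, 0 < e -> exists m, forall n,
     1 - e <= iter n (average K) (initial m) 0) ->
  exists Q : probability (zvec p) R,
    forall B, Q B = (\int[Q]_x K x B)%E.
Proof.
move=> cvgK tightK.
have [Q QP] := limit_law _ _ _ (fun n => iter_average_mean K n 0) cvgK tightK.
exists Q => B.
have B01 x : 0 <= (\1_B x : R) <= 1.
  by rewrite indicE; case: (_ \in _); rewrite ?lexx ?ler01.
have KB01 x : 0 <= average K \1_B x <= 1 by exact: (mean_itv (expect_mean _)).
rewrite expect_indic; under eq_integral do rewrite expect_indic.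
rewrite -EFin_expect; last exact: unit_is_bounded.
congr EFin; have := QP _ KB01.
rewrite (_ : (fun n => _) = fun n => iter n.+1 (average K) \1_B 0); last first.
  by apply/funext => n; rewrite iterSr.
rewrite (cvg_shiftS (fun n => iter n (average K) \1_B 0)) => h.
by apply: (@cvg_unique _ (@Rhausdorff R)) h; exact: QP.
Qed.

Lemma expect_stationary (R : realType) (p : nat)
    (K : zvec p -> probability (zvec p) R) (pi : probability (zvec p) R) :
  (forall B, pi B = (\int[pi]_x K x B)%E) ->
  forall phi, (forall x, 0 <= phi x <= 1) ->
  expect pi phi = expect pi (average K phi).
Proof.
move=> piK phi phi01.
have Kphi01 x : 0 <= average K phi x <= 1 by exact: (mean_itv (expect_mean _)).
apply: EFin_inj; rewrite expect_fibers//.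
rewrite EFin_expect; last exact: unit_is_bounded.
under [RHS]eq_integral do rewrite expect_fibers//.
have phi0 x : 0 <= phi x by have /andP[] := phi01 x.
rewrite integral_nneseries//; last first.
  by move=> k x _; rewrite mule_ge0// lee_fin.
apply: eq_eseriesr => k _.
by rewrite ge0_integralZl_EFin// piK.
Qed.

(** * The logarithmic moment as an integral and as a series *)

Section LogMoment.
Context {R : realType} {p : nat} (Q : probability (zvec p) R) (i : 'I_p).

Let lnn_ge0 (k : nat) : 0 <= ln (k%:R : R) := ln_nat_ge0 R k.

Lemma integral_ln_coordinate :
  (\int[Q]_x (ln ((x i 0)%:R : R))%:E =
   \sum_(1 <= k <oo) (ln (k%:R : R))%:E * Q [set x | x i 0%R = k])%E.
Proof.
have setTE : setT = \bigcup_k [set x : zvec p | x i 0 = k].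
  by apply/seteqP; split=> [x _|//]; exists (x i 0).
rewrite [X in integral _ X]setTE ge0_integral_bigcup//; last 2 first.
- by move=> x _; rewrite lee_fin.
- by move=> k l _ _ [x [/= <- <-]].
rewrite (eq_eseriesr
  (g := fun k => ((ln (k%:R : R))%:E * Q [set x | x i 0%R = k])%E)).
  (* The term [k = 0] is split off and vanishes by the convention [ln 0 = 0], so the series may
     start at 1. *)
  rewrite nneseries_recl//; last by move=> k _; apply: mule_ge0; rewrite ?lee_fin.
  by rewrite ln0// mul0e add0e.
move=> k _; rewrite -integral_cst//.
by apply: eq_integral => x; rewrite inE /= => ->.
Qed.

Lemma log_series_lty (B : R) :
  (forall N,
     expect Q (fun x => \sum_(k < N) ln (k%:R : R) * (x i 0 == k)%:R) <= B) ->
  (\sum_(1 <= k <oo) (ln (k%:R : R))%:E * Q [set x | x i 0%R = k] < +oo)%E.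
Proof.
move=> HB; apply: (@le_lt_trans _ _ B%:E); last exact: ltry.
have eqB k : is_bounded (fun x : zvec p => (x i 0 == k)%:R : R).
  by apply: unit_is_bounded => x; case: eqP; rewrite ?lexx ?ler01.
apply: lime_le.
  by apply: is_cvg_nneseries => k _ _; apply: mule_ge0; rewrite ?lee_fin.
apply: nearW => N; apply: le_trans (_ : (expect Q (fun x =>
  \sum_(k < N) ln (k%:R : R) * (x i 0 == k)%:R))%:E <= _)%E; last first.
  by rewrite lee_fin.
rewrite (mean_sum (expect_mean Q)); last by move=> k; exact: is_boundedZ.
rewrite -sumEFin -(big_mkord xpredT
  (fun k => (expect Q (fun x => ln (k%:R : R) * (x i 0 == k)%:R))%:E)).
have termE k : ((ln (k%:R : R))%:E * Q [set x | x i 0%R = k] =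
    (expect Q (fun x => ln (k%:R : R) * (x i 0 == k)%:R))%:E)%E.
  rewrite expectZ// EFinM expect_indic; congr (_ * (expect Q _)%:E)%E.
  by apply/funext => x; rewrite indicE; case: eqP => xk; [rewrite mem_set|rewrite memNset].
rewrite (eq_bigr _ (fun k _ => termE k)).
case: N => [|N]; first by rewrite !big_geq.
rewrite [leRHS]big_ltn// leeDr// lee_fin expectZ//.
by rewrite mulr_ge0//; apply: Rintegral_ge0 => x _; exact: ler0n.
Qed.

End LogMoment.

Theorem theorem2 (R : realType) (d : measure_display) (Omega : measurableType d)
    (P : probability Omega R) (p : nat) (p_gt0 : (0 < p)%N)
    (xi : 'I_p -> nat -> nat -> {RV P >-> zvec p})
    (eta X : nat -> {RV P >-> zvec p})
    (gwX : galton_watson xi eta X)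
    (subcritical : spectral_radius (mean_matrix xi) < 1) :
  (exists pi : probability (zvec p) R, stationary xi eta pi) <->
  (forall i : 'I_p, leads_to_cycle (mean_matrix xi) i ->
     (\sum_(1 <= k <oo) (ln (k%:R : R))%:E * P [set w | eta 0%N w i 0%R = k]
        < +oo)%E).
Proof.
pose K := gw_law P p xi eta.
have K_pgf s x : (forall i, 0 <= s i <= 1) -> expect (K x) (monomial s) =
    monomial (offspring_pgf (offspring_law P p xi) s) x *
    expect (innovation_law P p eta) (monomial s).
  by move=> s01; exact: (expect_gw_law_monomial _ _ _ _ _ gwX).
have LamI := offspring_integrable _ _ _ _ _ gwX.
have ME := mean_matrixE P p xi.
split=> [[pi piS] i iI|lnI].
- have piK B : pi B = (\int[pi]_x K x B)%E by exact: piS.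
  have pi_pgf s : (forall i, 0 <= s i <= 1) -> expect pi (monomial s) =
      expect pi (monomial (offspring_pgf (offspring_law P p xi) s)) *
      expect (innovation_law P p eta) (monomial s).
    move=> s01; rewrite (expect_stationary _ _ K pi piK (monomial s)); last first.
      by move=> x; exact: monomial_itv.
    rewrite mulrC -expectZ; last first.
      by apply: monomial_is_bounded; exact: (iter_pgf_itv _ s 1).
    by congr expect; apply/funext => x; rewrite /average K_pgf// mulrC.
  have [B HB] := log_moment_bounded _ _ ME _ _ pi_pgf i iI.
  exact: (log_series_lty (innovation_law P p eta) i B HB).
have [C [r [C0 r01 CrP]]] := mxpow_geometric_bound _ _ _ subcritical.
have K_antitone phi := expect_gw_law_antitone P p xi eta phi.
have [Q QK] : exists Q : probability (zvec p) R,
    forall B, Q B = (\int[Q]_x K x B)%E.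
  apply: exists_stationary_law.
    by move=> k; exact: iter_average_atom_is_cvg.
  apply: (iter_average_tight K (offspring_law P p xi) (innovation_law P p eta)).
    by move=> s s01 x; exact: K_pgf.
  apply: (sum_onem_innovation_pgf_small _ _ LamI ME _ C r C0 r01 CrP) => i iI.
  by rewrite integral_ln_coordinate; exact: lnI.
by exists Q => B _; exact: QK.
Qed.
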